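(* Let $q\ge 1$ be an integer and let $\underline{u}\in\mathbf{P}_{[q]}$, so that $u(x)=\mathbf{P}_{[q]}(x)\underline{u}$. Let $Q_{[q]}^{1/q}$ be the $q\times q$ block matrix (blocks indexed by $j,k=0,\dots,q-1$, each block an infinite matrix) $$ Q_{[q]}^{1/q}=\begin{pmatrix} & & & & S_{0,0}R_{0,0}Q^{1/q}_{1-1/q}\\ Q^{1/q}_{0} & & & & \\ & Q^{1/q}_{1/q} & & & \\ & & \ddots & & \\ & & & Q^{1/q}_{1-2/q} & \end{pmatrix}, $$ that is, block $(k+1,k)$ equals $Q^{1/q}_{k/q}$ for $k=0,\dots,q-2$, block $(0,q-1)$ equals $S_{0,0}R_{0,0}Q^{1/q}_{1-1/q}$, and all other blocks are zero. Then, for $-1<x\le 1$, $$ {}_{-1}\mathcal{Q}_x^{1/q}\,\mathbf{P}_{[q]}(x)\underline{u}=\mathbf{P}_{[q]}(x)\,Q_{[q]}^{1/q}\,\underline{u}. $$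
   Context: For $\nu>0$ the left-sided fractional integral is ${}_{-1}\mathcal{Q}_x^{\nu}f(x)=\frac{1}{\Gamma(\nu)}\int_{-1}^x\frac{f(t)}{(x-t)^{1-\nu}}\,dt$. $P_n^{(\alpha,\beta)}$ denotes the classical Jacobi polynomial (with $P_{-1}^{(\alpha,\beta)}=0$). An element $\underline{u}\in\mathbf{P}_{[q]}$ is a tuple $\underline{u}=(\underline{u}^{[0]},\dots,\underline{u}^{[q-1]})$ of coefficient sequences $\underline{u}^{[k]}=(u^{[k]}_n)_{n\ge0}$ of complex numbers, and $$\mathbf{P}_{[q]}(x)\underline{u}=\sum_{k=0}^{q-1}(1+x)^{k/q}\sum_{n=0}^\infty u_n^{[k]}P_n^{(1-k/q,\,k/q)}(x).$$ Standing convention: the sequences satisfy $\sum_{n\ge0}|u^{[k]}_n|\sup_{-1\le x\le1}|P_n^{(1-k/q,\,k/q)}(x)|<\infty$ for each $k$, so that the expansion defines a continuous function. For $\mu>0$ and $\beta\ge0$, $Q^{\mu}_{\beta}$ is the infinite diagonal matrix with $n$-th diagonal entry $\frac{\Gamma(\beta+n+1)}{\Gamma(\beta+\mu+n+1)}$, $n=0,1,2,\dots$. $R_{0,0}$ is the infinite (lower bidiagonal) matrix induced by the relation $(1+x)P_n^{(0,1)}(x)=P_{n+1}^{(0,0)}(x)+P_n^{(0,0)}(x)$, i.e. its $n$-th column has entries $1$ in rows $n$ and $n+1$ and zeros elsewhere. $S_{0,0}$ is the infinite (upper bidiagonal) matrix induced by $(2n+1)P_n^{(0,0)}(x)=(n+1)P_n^{(1,0)}(x)-nP_{n-1}^{(1,0)}(x)$,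 i.e. its $n$-th column has entry $\frac{n+1}{2n+1}$ in row $n$, entry $-\frac{n}{2n+1}$ in row $n-1$ (if $n\ge1$), and zeros elsewhere. *)

(* Defs.v *)
From HB Require Import structures.
From mathcomp Require Import all_boot all_order all_algebra.
From mathcomp Require Import all_classical all_reals all_analysis.
From mathcomp Require Import complex.

Set Implicit Arguments.
Unset Strict Implicit.
Unset Printing Implicit Defensive.

Import Order.TTheory GRing.Theory Num.Theory.
Import numFieldNormedType.Exports.

Local Open Scope classical_set_scope.
Local Open Scope ring_scope.
Local Open Scope complex_scope.

(* The ascription gives R[i] the norm topology of a numFieldType. *)
Definition csum (R : realType) (v : nat -> R[i]) : R[i] :=
  limn (series (v : nat -> (R[i] : numFieldType))).

Definition cintegral (R : realType) (D : set R) (f : R -> R[i]) : R[i] :=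
  (\int[lebesgue_measure]_(t in D) complex.Re (f t)) +i*
  (\int[lebesgue_measure]_(t in D) complex.Im (f t)).

Definition Gamma (R : realType) (s : R) : R :=
  \int[lebesgue_measure]_(t in `]0, +oo[) (t `^ (s - 1) * expR (- t)).

(* At t = x the integrand takes a conventional value (x^-1 = 0 at 0), on a
   null set. *)
Definition fracint (R : realType) (nu : R) (f : R -> R[i]) (x : R) : R[i] :=
  ((Gamma nu)^-1)%:C *
  cintegral `[-1, x] (fun t => f t / ((x - t) `^ (1 - nu))%:C).

Definition gbinom (R : realType) (z : R) (m : nat) : R :=
  (\prod_(i < m) (z - i%:R)) / m`!%:R.

(* Szego's explicit formula, normalised by P_n(1) = binom(n + alpha, n). *)
Definition jacobi (R : realType) (alpha beta : R) (n : nat) : {poly R} :=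
  \sum_(l < n.+1)
    (gbinom (n%:R + alpha) l * gbinom (n%:R + beta) (n - l) / 2 ^+ n)
      *: (('X - 1) ^+ (n - l) * ('X + 1) ^+ l).

Definition jacobi_sup (R : realType) (alpha beta : R) (n : nat) : R :=
  sup [set `|(jacobi alpha beta n).[x]| | x in `[-1, 1]%classic].

Section SumSpace.
Variables (R : realType) (q : nat).

Definition blockseq : Type := 'I_q -> nat -> R[i].

Definition bexp (k : 'I_q) : R := k%:R / q%:R.

(* The standing convention making P_[q](x) u a continuous function of x. *)
Definition sumspace : set blockseq :=
  [set u | forall k : 'I_q,
     cvgn (series (fun n =>
       Normc.normc (u k n) * jacobi_sup (1 - bexp k) (bexp k) n))].

Definition sumspace_eval (u : blockseq) (x : R) : R[i] :=
  \sum_(k < q) ((1 + x) `^ bexp k)%:C *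
    csum (fun n => u k n * ((jacobi (1 - bexp k) (bexp k) n).[x])%:C).

End SumSpace.

Section InfiniteMatrices.
Variable R : realType.

(* A m n is the entry in row m, column n. *)
Definition imx : Type := nat -> nat -> R[i].

Definition imx_mul (A B : imx) : imx :=
  fun m n => csum (fun l => A m l * B l n).

Definition imx_app (A : imx) (v : nat -> R[i]) : nat -> R[i] :=
  fun m => csum (fun n => A m n * v n).

Definition Qmx (mu beta : R) : imx := fun m n =>
  if m == n
  then (Gamma (beta + n%:R + 1) / Gamma (beta + mu + n%:R + 1))%:C
  else 0.

Definition R00 : imx := fun m n =>
  if (m == n) || (m == n.+1) then 1 else 0.

Definition S00 : imx := fun m n =>
  if m == n then n.+1%:R / (2 * n + 1)%:R
  else if m.+1 == n then - (n%:R / (2 * n + 1)%:R)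
  else 0.

Definition bmx_app (q : nat) (A : 'I_q -> 'I_q -> imx) (u : blockseq R q) :
    blockseq R q :=
  fun j m => \sum_(k < q) imx_app (A j k) (u k) m.

Definition Qblock (q : nat) : 'I_q -> 'I_q -> imx := fun j k =>
  if j == k.+1 :> nat then Qmx q%:R^-1 (k%:R / q%:R)
  else if (j == 0 :> nat) && (k.+1 == q) then
    imx_mul (imx_mul S00 R00) (Qmx q%:R^-1 (1 - q%:R^-1))
  else fun _ _ => 0.

End InfiniteMatrices.

(* Main.v *)
Require Import Defs.
From HB Require Import structures.
From mathcomp Require Import all_boot all_order all_algebra.
From mathcomp Require Import all_classical all_reals all_analysis.
From mathcomp Require Import complex.
From mathcomp Require Import measurable_realfun polyrcf ring lra zify.

Import Order.TTheory GRing.Theory Num.Theory.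
Import numFieldNormedType.Exports.

Local Open Scope classical_set_scope.
Local Open Scope ring_scope.
Local Open Scope complex_scope.

(** For all real [a], all [b >= 0], [nu > 0] and [x > -1], the fractional integral
    of order [nu] satisfies
      [I^nu ((1 + t)^b P_n^(a,b)) (x)
         = Gamma (b+n+1) / Gamma (b+nu+n+1) * (1 + x)^(b+nu) P_n^(a-nu,b+nu) (x)]
    ([frac_integral_jacobi]).  Indeed [P_n^(a,b)] is a combination of the powers
    [(1 + x)^m] whose coefficients depend on [a] and [b] only through [a + b] and
    a binomial coefficient of [n + b] ([jacobi_jpoly]); each power is integrated
    by Euler's Beta integral ([frac_integral_powR]), and the functional equation
    of Gamma makes the resulting factor independent of [m] ([jcoef_frac]).

    With [nu = 1/q] this sends the block with exponent [k/q] to the block with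
    exponent [(k+1)/q], the coefficient sequence being multiplied by a diagonal
    matrix.  The last block lands on [(1 + x) P_n^(0,1)], and two contiguous
    relations rewrite the result in the basis [P_n^(1,0)] of the first block
    ([jacobi_block_corner]).

    Three analytic points remain.  Sum and integral are exchanged by dominated
    convergence ([jacobi_series_frac]).  The new coefficients are again
    summable against the sup norms because the kernel of the fractional integral
    is positive: bounding [P_n^(a,b)] by its sup norm inside the formula above
    bounds the sup norm of [P_n^(a-nu,b+nu)], with a constant independent of [n]
    ([jacobi_sup_frac]).  For the corner block, [|P_n^(0,1)(-1)| = n + 1],
    while [|P_n^(1,0)| <= n + 1] on [[-1,1]] since Legendre polynomials are
    bounded by 1 ([norm_legendre_le1]); so both re-expansions cost only bounded
    factors and the boundary terms of the summation by parts vanish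
    ([S00_R00_series_cvg]).

    The Gamma function being given by its integral, the Beta integral is derived
    from Tonelli's theorem ([beta_gamma]), which also yields the finiteness,
    the positivity and the functional equation of Gamma. *)

(** * Euler's integrals and the fractional integral of a power *)

Section EulerIntegrals.
Context {R : realType}.
Implicit Types (a b s v x t : R) (f : R -> \bar R).
Local Notation mu := (@lebesgue_measure R).

Lemma measurable_affine a b : measurable_fun setT (fun x : R => a * x + b).
Proof. by apply: measurable_funD => //; exact: measurable_funM. Qed.

(** The image of Lebesgue measure under an affine map, rescaled, agrees with
    Lebesgue measure on intervals, hence everywhere; this gives the change of
    variables for every nonnegative measurable function, bounded or not. *)
Lemma ge0_integral_affine a b f : 0 < a ->
  measurable_fun [set: R] f -> (forall x, 0 <= f x)%E ->
  (\int[mu]_x f x = a%:E * \int[mu]_x f (a * x + b)%R)%E.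
Proof.
move=> a0 mf f0.
pose phi : measurableTypeR R -> measurableTypeR R := fun x => a * x + b.
have mphi : measurable_fun [set: measurableTypeR R] phi.
  exact: measurable_affine.
pose scaled_image : {measure set (measurableTypeR R) -> \bar R} :=
  mscale (NngNum (ltW a0)) (pushforward mu phi).
pose nu := scaled_image mphi.
have -> : (\int[mu]_x f x = \int[nu]_x f x)%E.
  apply: eq_measure_integral => A mA _ /=.
  apply: lebesgue_measure_unique => // _ [[c d]] _ <-.
  rewrite /nu /scaled_image /= /mscale /=.
  rewrite -[pushforward _ _ _]/(mu (phi @^-1` [set` `]c, d]])).
  have -> : phi @^-1` [set` `]c, d]]
      = [set` `](c - b) / a, (d - b) / a]].
    apply/seteqP; split=> x; rewrite /phi /= !in_itv /= ltr_pdivrMr// ler_pdivlMr//;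
    by rewrite ltrBlDr lerBrDr mulrC.
  rewrite !lebesgue_measure_itv/= !lte_fin ltr_pM2r ?invr_gt0// ltrD2r.
  case: ifP => _; last by rewrite mule0.
  rewrite -!EFinD -EFinM; congr EFin; field.
  exact: lt0r_neq0.
rewrite ge0_integral_mscale //=; congr (_ * _)%E.
by rewrite ge0_integral_pushforward// preimage_setT.
Qed.

(** Extending the power by zero to the negative half-line turns the integrals
    over [(0, +oo)] and [(0, v)] below into integrals over the whole line, where
    affine changes of variables and Tonelli's theorem need no bookkeeping of
    domains. *)
Definition powk (s x : R) : R := if 0 < x then x `^ (s - 1) else 0.

Lemma powk_ge0 s x : 0 <= powk s x.
Proof. by rewrite /powk; case: ifP => // _; exact: powR_ge0. Qed.

Lemma powk_le0 s x : x <= 0 -> powk s x = 0.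
Proof. by rewrite /powk => x0; rewrite ltNge x0. Qed.

Lemma powk_gt0 s x : 0 < x -> powk s x = x `^ (s - 1).
Proof. by rewrite /powk => ->. Qed.

Lemma measurable_powk s : measurable_fun [set: R] (powk s).
Proof.
apply: measurable_fun_ifT => //=.
exact: measurable_fun_ltr.
Qed.

Lemma powkM s v x : 0 < v -> powk s (v * x) = v `^ (s - 1) * powk s x.
Proof.
move=> v0; rewrite /powk pmulr_rgt0//; case: ifP => x0; last by rewrite mulr0.
by rewrite powRM ?ltW.
Qed.

(** The Gamma and convolution integrals are first taken in the extended reals,
    where Tonelli's theorem applies before anything is known to be finite. *)
Definition egamma (s : R) : \bar R := (\int[mu]_t (powk s t * expR (- t))%:E)%E.

Definition econv (a b v : R) : \bar R :=
  (\int[mu]_s (powk a s * powk b (v - s))%:E)%E.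

Lemma Gamma_egamma s : Gamma s = fine (egamma s).
Proof.
rewrite /Gamma /egamma /Rintegral; congr fine.
rewrite integral_mkcond; apply: eq_integral => t _.
rewrite patchE; case: ifPn => [|].
  by rewrite inE /= in_itv/= andbT => t0; rewrite powk_gt0.
rewrite notin_setE /= in_itv/= andbT => /negP; rewrite -leNgt => t0.
by rewrite powk_le0// mul0r.
Qed.

Lemma measurable_gamma_integrand s :
  measurable_fun [set: R] (fun t => powk s t * expR (- t)).
Proof.
apply: measurable_funM; first exact: measurable_powk.
exact: (measurableT_comp (@measurable_expR R)).
Qed.

Lemma measurable_conv_integrand a b v :
  measurable_fun [set: R] (fun s => powk a s * powk b (v - s)).
Proof.
apply: measurable_funM; first exact: measurable_powk.
apply: (measurableT_comp (measurable_powk b)).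
exact: measurable_funB.
Qed.

Lemma egamma_ge0 s : (0 <= egamma s)%E.
Proof.
by apply: integral_ge0 => t _; rewrite lee_fin mulr_ge0 ?powk_ge0 ?expR_ge0.
Qed.

Lemma econv_ge0 a b v : (0 <= econv a b v)%E.
Proof.
by apply: integral_ge0 => t _; rewrite lee_fin mulr_ge0 ?powk_ge0.
Qed.

(** Homogeneity: substitute [s = v s']. *)
Lemma econv_scale a b v : econv a b v = ((powk (a + b) v)%:E * econv a b 1)%E.
Proof.
have [v0|v0] := ltP 0 v; last first.
  rewrite powk_le0// mul0e; apply: integral0_eq => s _.
  have [s0|s0] := ltP 0 s; last by rewrite powk_le0// mul0r.
  by rewrite [powk b _]powk_le0 ?mulr0// subr_le0 (le_trans v0)// ltW.
rewrite /econv (ge0_integral_affine v 0 _ v0); last 2 first.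
- apply/measurable_EFinP; exact: measurable_conv_integrand.
- by move=> s; rewrite lee_fin mulr_ge0 ?powk_ge0.
under eq_integral => s _.
  rewrite addr0 -{2}(mulr1 v) -mulrBr !powkM// mulrACA EFinM.
  over.
rewrite ge0_integralZl//; last 3 first.
- apply/measurable_EFinP; exact: measurable_conv_integrand.
- by move=> s _; rewrite lee_fin mulr_ge0 ?powk_ge0.
- by rewrite lee_fin mulr_ge0 ?powR_ge0.
rewrite muleA -EFinM; congr (_%:E * _)%E.
rewrite powk_gt0// -powRD; last by rewrite (gt_eqF v0) implybT.
rewrite -{1}(powRr1 (ltW v0)) -powRD; last by rewrite (gt_eqF v0) implybT.
congr (_ `^ _); ring.
Qed.

(** In [egamma a * egamma b], seen as an integral over [s] and [t], put
    [v = s + t] and exchange the integrals: the inner one becomes the convolution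
    [econv a b v], which [econv_scale] reduces to the Beta integral
    [econv a b 1]. *)
Lemma beta_gamma a b :
  (egamma a * egamma b = econv a b 1 * egamma (a + b))%E.
Proof.
pose h (p : R * R) : \bar R :=
  ((powk a p.1 * powk b (p.2 - p.1)) * expR (- p.2))%:E.
have mh : measurable_fun [set: R * R] h.
  apply/measurable_EFinP; apply: measurable_funM.
    apply: measurable_funM.
      exact: (measurableT_comp (measurable_powk a)).
    apply: (measurableT_comp (measurable_powk b)).
    exact: measurable_funB.
  apply: (measurableT_comp (@measurable_expR R)).
  exact: measurable_funN.
have h0 p : (0 <= h p)%E.
  by rewrite lee_fin !mulr_ge0 ?powk_ge0 ?expR_ge0.
transitivity (\int[mu]_s \int[mu]_v h (s, v))%E.
  rewrite muleC -ge0_integralZl//; last 3 first.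
  - apply/measurable_EFinP; exact: measurable_gamma_integrand.
  - by move=> s _; rewrite lee_fin mulr_ge0 ?powk_ge0 ?expR_ge0.
  - exact: egamma_ge0.
  apply: eq_integral => s _.
  rewrite muleC /egamma (ge0_integral_affine 1 (- s) _ ltr01); last 2 first.
  - apply/measurable_EFinP; exact: measurable_gamma_integrand.
  - by move=> t; rewrite lee_fin mulr_ge0 ?powk_ge0 ?expR_ge0.
  rewrite mul1e -ge0_integralZl//; last 3 first.
  - apply/measurable_EFinP.
    have := measurable_affine 1 (- s).
    by move=> /(measurableT_comp (measurable_gamma_integrand b)).
  - by move=> t _; rewrite lee_fin mulr_ge0 ?powk_ge0 ?expR_ge0.
  - by rewrite lee_fin mulr_ge0 ?powk_ge0 ?expR_ge0.
  apply: eq_integral => v _; rewrite -EFinM /h/= mul1r; congr EFin.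
  rewrite mulrACA -expRD; congr (_ * expR _); ring.
have -> := @fubini_tonelli _ _ _ _ _ mu mu h mh h0.
rewrite muleC /egamma.
transitivity (\int[mu]_v ((expR (- v))%:E * econv a b v))%E.
  apply: eq_integral => v _; rewrite /econv -ge0_integralZl//.
  - by apply: eq_integral => s _; rewrite -EFinM /h/= mulrC.
  - apply/measurable_EFinP; exact: measurable_conv_integrand.
  - by move=> s _; rewrite lee_fin mulr_ge0 ?powk_ge0.
rewrite muleC -ge0_integralZl//.
- by apply: eq_integral => v _; rewrite econv_scale muleA -EFinM mulrC muleC.
- apply/measurable_EFinP; exact: measurable_gamma_integrand.
- by move=> s _; rewrite lee_fin mulr_ge0 ?powk_ge0 ?expR_ge0.
- exact: econv_ge0.
Qed.

Lemma integral_powR_itv a c : 0 < a -> 0 < c -> c < 1 ->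
  (\int[mu]_(x in `[c, 1%R]) (x `^ (a - 1))%:E = (a^-1 - a^-1 * c `^ a)%:E)%E.
Proof.
move=> a0 c0 c1.
have dF x : 0 < x -> is_derive x 1 (fun x => a^-1 * x `^ a) (x `^ (a - 1)).
  move=> x0; have H := @is_derive1_powR R a x x0.
  apply: is_derive_eq.
  by rewrite /GRing.scale/= mulrA mulVf ?mul1r// gt_eqF.
have dP x : 0 < x -> derivable (fun x : R => x `^ (a - 1)) x 1.
  by move=> x0; have [] := @is_derive1_powR R (a - 1) x x0.
have cF x : 0 < x -> {for x, continuous (fun x : R => a^-1 * x `^ a)}.
  by move=> x0; apply/differentiable_continuous/derivable1_diffP; have [] := dF x x0.
rewrite (@continuous_FTC2 R _ (fun x => a^-1 * x `^ a))//.
- by rewrite powR1 mulr1 -EFinB.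
- apply: derivable_within_continuous => x; rewrite in_itv/= => /andP[cx _].
  by apply: dP; exact: lt_le_trans cx.
- split.
  + move=> x; rewrite in_itv/= => /andP[cx _].
    by have [] := dF x (lt_trans c0 cx).
  + exact/cvg_at_right_filter/cF.
  + exact/cvg_at_left_filter/cF.
- move=> x; rewrite in_itv/= => /andP[cx _].
  by rewrite derive1E; have [_] := dF x (lt_trans c0 cx).
Qed.

(** The integrand may blow up at 0, so the interval is exhausted by
    [[1/(n+2), 1]], on which the fundamental theorem of calculus applies. *)
Lemma integral_powR01 a : 0 < a ->
  (\int[mu]_(x in `]0%R, 1%R]) (x `^ (a - 1))%:E = (a^-1)%:E)%E.
Proof.
move=> a0.
pose c n : R := n.+2%:R^-1.
have c0 n : 0 < c n by rewrite invr_gt0.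
have c1 n : c n < 1 by rewrite invf_lt1// ltr1n.
have cc : c n @[n --> \oo] --> 0.
  have := @cvg_harmonic R; rewrite -(@cvg_shiftS R); exact.
have -> : `]0, 1]%classic = \bigcup_n `[c n, 1]%classic.
  apply/seteqP; split=> x /=; rewrite ?in_itv/=.
    move=> /andP[x0 x1].
    have := @cvgr_lt _ _ _ _ _ _ cc x x0.
    move=> [N _ /(_ N (leqnn N)) /= cx].
    by exists N => //=; rewrite in_itv/= x1 ltW.
  by move=> [n _] /=; rewrite !in_itv/= => /andP[cx ->]; rewrite (lt_le_trans _ cx).
have mf (A : set R) : measurable_fun A (fun x : R => (x `^ (a - 1))%:E).
  by apply/measurable_EFinP; apply: measurable_funTS; exact: measurable_powR.
have cvg_union : (\int[mu]_(x in `[c n, 1%R]) (x `^ (a - 1))%:E)%E @[n --> \oo]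
    --> (\int[mu]_(x in \bigcup_n [set` `[c n, 1%R]]) (x `^ (a - 1))%:E)%E.
  apply: (@ge0_nondecreasing_set_cvg_integral _ (measurableTypeR R)) => //.
  - move=> m n mn; apply/subsetPset => x /=; rewrite !in_itv/= => /andP[cx ->].
    rewrite andbT (le_trans _ cx)// lef_pV2 ?posrE//.
    by rewrite ler_nat.
  - by move=> i; exact: mf.
  - by move=> i x _; rewrite lee_fin powR_ge0.
apply: cvg_unique cvg_union _ => //=.
under eq_cvg do rewrite integral_powR_itv//.
apply: cvg_EFin; first exact: nearW.
rewrite -[X in _ --> X]subr0 -[X in _ - X](mulr0 a^-1).
apply: cvgB; first exact: cvg_cst.
apply: cvgMr.
have /cvg_at_rightP := @powR_cvg0 R a a0.
by apply.
Qed.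

Lemma econv11 a : 0 < a -> econv a 1 1 = (a^-1)%:E.
Proof.
move=> a0; rewrite -(integral_powR01 a a0) -integral_itv_bndo_bndc; last first.
  by apply/measurable_EFinP; apply: measurable_funTS; exact: measurable_powR.
rewrite [RHS]integral_mkcond; apply: eq_integral => t _.
rewrite patchE; case: ifPn => [|].
  rewrite inE /= in_itv/= => /andP[t0 t1].
  by rewrite !powk_gt0 ?subr_gt0// subrr powRr0 mulr1.
rewrite notin_setE /= in_itv/= => /negP; rewrite negb_and -!leNgt => /orP[t0|t1].
  by rewrite powk_le0// mul0r.
by rewrite [powk 1 _]powk_le0 ?mulr0// subr_le0.
Qed.

Lemma egamma1 : egamma 1 = 1%E :> \bar R.
Proof.
transitivity (\int[mu]_(t in `[0%R, +oo[) (expR (- t))%:E)%E.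
  rewrite -integral_itv_obnd_cbnd; last first.
    apply/measurable_EFinP; apply: measurable_funTS.
    exact: (measurableT_comp (@measurable_expR R)).
  rewrite [RHS]integral_mkcond; apply: eq_integral => t _.
  rewrite patchE; case: ifPn => [|].
    rewrite inE /= in_itv/= andbT => t0.
    by rewrite powk_gt0 ?subrr ?powRr0 ?mul1r.
  rewrite notin_setE /= in_itv/= andbT => /negP; rewrite -leNgt => t0.
  by rewrite powk_le0// mul0r.
have dF x : is_derive x 1 (fun x => - expR (- x)) (expR (- x)).
  by apply: is_derive_eq; rewrite mulrN1 opprK.
have dP x : is_derive x 1 (fun x : R => expR (- x)) (- expR (- x)).
  by apply: is_derive_eq; rewrite mulrN1.
have cF x : {for x, continuous (fun x : R => - expR (- x))}.
  by apply/differentiable_continuous/derivable1_diffP; have [] := dF x.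
rewrite (@ge0_continuous_FTC2y R _ (fun x => - expR (- x)) 0 0)//.
- by rewrite oppr0 expR0 sub0e -EFinN opprK.
- by apply: derivable_within_continuous => x _; have [] := dP x.
- by rewrite -oppr0; apply: cvgN; exact: cvgr_expR.
- exact/cvg_at_right_filter/cF.
- by move=> x _; rewrite derive1E; have [_] := dF x.
Qed.

Lemma econv1_le a b : 0 < a -> 1 <= b -> (econv a b 1 <= (a^-1)%:E)%E.
Proof.
move=> a0 b1; rewrite -(econv11 a a0) /econv.
apply: ge0_le_integral => //.
- by move=> t _; rewrite lee_fin mulr_ge0 ?powk_ge0.
- by apply/measurable_EFinP; exact: measurable_conv_integrand.
- by apply/measurable_EFinP; exact: measurable_conv_integrand.
move=> t _; rewrite lee_fin.
have [t0|t0] := ltP 0 t; last by rewrite powk_le0// !mul0r.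
apply: ler_wpM2l; first exact: powk_ge0.
have [t1|t1] := ltP t 1; last by rewrite !powk_le0// subr_le0.
rewrite !powk_gt0 ?subr_gt0// subrr powRr0.
rewrite -[leRHS](powRr0 (1 - t)); apply: ger_powR.
  by rewrite subr_gt0 t1 lerBlDr lerDl ltW.
by rewrite subr_ge0.
Qed.

(** [beta_gamma] at [b = 1], where the Beta integral is elementary. *)
Lemma egammaS a : 0 < a -> egamma (a + 1) = (a%:E * egamma a)%E.
Proof.
move=> a0; have := beta_gamma a 1; rewrite egamma1 mule1 econv11// => ->.
by rewrite muleA -EFinM divff ?mul1e// gt_eqF.
Qed.

(** For [b >= 1] the integrand of Gamma dominates [exp (- t)] on [t >= 1]; the
    functional equation brings the general case back to this one. *)
Lemma egamma_gt0 a : 0 < a -> (0 < egamma a)%E.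
Proof.
suff H b : 1 <= b -> (0 < egamma b)%E.
  move=> a0; have : (0 < egamma (a + 1))%E by apply: H; rewrite lerDr ltW.
  by rewrite egammaS// pmule_rgt0// lte_fin.
move=> b1; apply: (@lt_le_trans _ _ (expR (-1))%:E); first by rewrite lte_fin expR_gt0.
rewrite -[leLHS]mule1 -egamma1.
(* the integral of [exp (- t)] over [t >= 1], translated to [t >= 0] *)
rewrite {2}/egamma (ge0_integral_affine 1 1)//; last 2 first.
- by apply/measurable_EFinP; exact: measurable_gamma_integrand.
- by move=> t; rewrite lee_fin mulr_ge0 ?powk_ge0 ?expR_ge0.
rewrite mul1e /egamma -ge0_integralZl//; last 2 first.
- by apply/measurable_EFinP; exact: measurable_gamma_integrand.
- by move=> t _; rewrite lee_fin mulr_ge0 ?powk_ge0 ?expR_ge0.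
apply: ge0_le_integral => //.
- by move=> t _; rewrite -EFinM lee_fin !mulr_ge0 ?powk_ge0 ?expR_ge0.
- apply/measurable_EFinP; apply: measurable_funM => //.
  exact: measurable_gamma_integrand.
- apply/measurable_EFinP.
  exact: (measurableT_comp (measurable_gamma_integrand b) (measurable_affine 1 1)).
move=> t _; rewrite -EFinM lee_fin mul1r.
rewrite mulrCA -expRD -opprD (addrC 1 t).
apply: ler_wpM2r; first exact: expR_ge0.
have [t0|t0] := ltP 0 t; last by rewrite powk_le0 ?powk_ge0.
rewrite !powk_gt0 ?addr_gt0// subrr powRr0.
rewrite -[leLHS](powRr0 (t + 1)); apply: ler_powR; first by rewrite lerDr ltW.
by rewrite subr_ge0.
Qed.

(** Gamma is finite at positive integers by the functional equation.  For a
    large integer [N], the relation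
    [egamma a * egamma (N - a) = econv a (N - a) 1 * egamma N] has a finite right
    side by [econv1_le], and [egamma (N - a)] is not zero, so [egamma a] is finite. *)
Lemma egamma_fin a : 0 < a -> egamma a \is a fin_num.
Proof.
have Hn (n : nat) : egamma (n.+1%:R : R) \is a fin_num.
  elim: n => [|n IH]; first by rewrite egamma1.
  by rewrite -[n.+2]addn1 natrD egammaS// fin_numM.
move=> a0; have [n an] : exists n : nat, a + 1 <= n.+1%:R.
  exists (Num.truncn (a + 1)); apply: ltW.
  by rewrite truncnS_gt.
have H := beta_gamma a (n.+1%:R - a).
rewrite (addrC a) subrK in H.
have n1 : 1 <= n.+1%:R - a by rewrite lerBrDl.
have n0 : (0 < egamma (n.+1%:R - a))%E.
  by apply: egamma_gt0; exact: lt_le_trans n1.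
have := econv1_le _ _ a0 n1; have := econv_ge0 a (n.+1%:R - a) 1.
have := Hn n; have := egamma_ge0 a; move: n0 H.
move: (egamma a) (egamma (_ - a)) (egamma n.+1%:R) (econv _ _ _) => x y d c.
move=> y0 xy x0 /fineK dfin c0 c1.
have /fineK cfin : c \is a fin_num.
  by rewrite ge0_fin_numE// (le_lt_trans c1)// ltry.
move: xy; rewrite -cfin -dfin -EFinM; case: x x0 => [//| |//] _.
by rewrite gt0_mulye.
Qed.

Lemma egammaE a : 0 < a -> egamma a = (Gamma a)%:E.
Proof. by move=> a0; rewrite Gamma_egamma fineK// egamma_fin. Qed.

Lemma Gamma_gt0 a : 0 < a -> 0 < Gamma a.
Proof. by move=> a0; rewrite -lte_fin -egammaE// egamma_gt0. Qed.

Lemma GammaS a : 0 < a -> Gamma (a + 1) = a * Gamma a.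
Proof.
move=> a0; apply: EFin_inj.
by rewrite EFinM -!egammaE ?egammaS// addr_gt0.
Qed.

Lemma econv1E a b : 0 < a -> 0 < b ->
  econv a b 1 = (Gamma a * Gamma b / Gamma (a + b))%:E.
Proof.
move=> a0 b0; have ab0 : 0 < a + b by rewrite addr_gt0.
have := beta_gamma a b; rewrite !egammaE//; move: (econv _ _ _) => c.
have /gt_eqF/negbT := Gamma_gt0 (a + b) ab0.
move: (Gamma (a + b)) (Gamma a) (Gamma b) => G Ga Gb G0 H.
by rewrite EFinM EFinM H -muleA -EFinM divff// mule1.
Qed.

(** Integrand of the fractional integral of order [nu] at [x] of
    [t |-> (1 + t)^b], up to the factor [1 / Gamma nu]. *)
Definition frac_kernel b nu x t : R := (1 + t) `^ b / (x - t) `^ (1 - nu).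

Lemma frac_kernel_ge0 b nu x t : 0 <= frac_kernel b nu x t.
Proof. by rewrite divr_ge0 ?powR_ge0. Qed.

Lemma measurable_frac_kernel b nu x :
  measurable_fun [set: R] (frac_kernel b nu x).
Proof.
apply: measurable_funM.
  apply: (@measurableT_comp _ _ _ _ _ _ (fun y : R => y `^ b) _ (fun t => 1 + t)).
    exact: measurable_powR.
  exact: measurable_funD.
apply: (@eq_measurable_fun _ _ _ _ _ (fun t => (x - t) `^ (- (1 - nu)))).
  by move=> t _; rewrite powRN.
apply: (@measurableT_comp _ _ _ _ _ _ (fun y : R => y `^ (- (1 - nu))) _
  (fun t => x - t)).
  exact: measurable_powR.
exact: measurable_funB.
Qed.

(** After the translation [s = 1 + t] this is the convolution of two powers. *)
Lemma frac_integral_powR b nu x : 0 < b + 1 -> 0 < nu -> -1 < x ->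
  (\int[mu]_(t in `[(-1)%R, x]) (frac_kernel b nu x t)%:E =
   (Gamma (b + 1) * Gamma nu / Gamma (b + 1 + nu) * (1 + x) `^ (b + nu))%:E)%E.
Proof.
move=> b0 nu0 x1.
have x0 : 0 < 1 + x by rewrite -ltrBlDl sub0r.
have mf (A : set R) : measurable_fun A (fun t : R => (frac_kernel b nu x t)%:E).
  by apply/measurable_EFinP; apply: measurable_funTS; exact: measurable_frac_kernel.
(* drop the end points, where a base vanishes: they form a null set *)
rewrite -integral_itv_bndo_bndc// -integral_itv_obnd_cbnd//.
transitivity (econv (b + 1) nu (1 + x)).
  rewrite /econv (ge0_integral_affine 1 1)//; last 2 first.
  - by apply/measurable_EFinP; exact: measurable_conv_integrand.
  - by move=> t; rewrite lee_fin mulr_ge0 ?powk_ge0.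
  rewrite mul1e integral_mkcond; apply: eq_integral => t _.
  rewrite mul1r (addrC t) opprD addrACA subrr add0r.
  rewrite patchE; case: ifPn => [|].
    rewrite inE /= in_itv/= => /andP[t1 tx].
    rewrite !powk_gt0 ?subr_gt0//; last by rewrite -ltrBlDl sub0r.
    by rewrite /frac_kernel addrK -[nu - 1]opprB powRN.
  rewrite notin_setE /= in_itv/= => /negP; rewrite negb_and -!leNgt => /orP[t0|t1].
    by rewrite powk_le0 ?mul0r// -lerBrDl sub0r.
  by rewrite [powk nu _]powk_le0 ?mulr0// subr_le0.
rewrite econv_scale econv1E// -EFinM powk_gt0//; congr EFin.
rewrite mulrC; congr (_ * _ `^ _); ring.
Qed.

End EulerIntegrals.

(** * Jacobi polynomials in powers of 1 + x *)

Section JacobiPolynomials.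
Context {R : realType}.
Implicit Types (a b z x y : R).
Local Notation mu := (@lebesgue_measure R).

Lemma gbinom0 z : gbinom z 0 = 1.
Proof. by rewrite /gbinom big_ord0 fact0 divr1. Qed.

Lemma gbinomS z m : m.+1%:R * gbinom z m.+1 = (z - m%:R) * gbinom z m.
Proof.
rewrite /gbinom big_ord_recr/= factS natrM.
have : m.+1%:R != 0 :> R by rewrite pnatr_eq0.
have : m`!%:R != 0 :> R by rewrite pnatr_eq0 -lt0n fact_gt0.
move: (m.+1%:R) (m`!%:R) => c d d0 c0; field.
by rewrite c0 d0.
Qed.

Lemma mulfI_natS m (x y : R) : m.+1%:R * x = m.+1%:R * y -> x = y.
Proof. by apply: mulfI; rewrite pnatr_eq0. Qed.

Lemma gbinom_nat n m : gbinom (n%:R : R) m = 'C(n, m)%:R.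
Proof.
elim: m => [|m IH]; first by rewrite gbinom0 bin0.
apply: (mulfI_natS m); rewrite gbinomS IH -natrM mul_bin_left natrM.
have [mn|nm] := leqP m n; first by rewrite natrB.
by rewrite bin_small// !mulr0.
Qed.

(** Split the factor [m + 1] as [l + (m + 1 - l)] and absorb each part with
    [gbinomS]: both sides satisfy the same first-order recurrence in [m]. *)
Lemma gbinom_vandermonde x y m :
  \sum_(l < m.+1) gbinom x l * gbinom y (m - l) = gbinom (x + y) m.
Proof.
elim: m => [|m IH]; first by rewrite big_ord1 !gbinom0 mulr1.
apply: (mulfI_natS m); rewrite gbinomS -IH !mulr_sumr.
transitivity (\sum_(l < m.+2)
    ((l%:R * gbinom x l) * gbinom y (m.+1 - l) +
     gbinom x l * ((m.+1 - l)%:R * gbinom y (m.+1 - l)))).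
  apply: eq_bigr => l _.
  have -> : m.+1%:R = l%:R + (m.+1 - l)%:R :> R.
    by rewrite -natrD subnKC// -ltnS.
  ring.
rewrite big_split/= big_ord_recl/= !mul0r add0r.
rewrite [X in _ + X]big_ord_recr/= subnn mul0r mulr0 addr0 -big_split/=.
apply: eq_bigr => l _.
have lm : (l <= m)%N by rewrite -ltnS.
rewrite /bump/= add1n subSS gbinomS subSn// gbinomS natrB//.
ring.
Qed.

Lemma gbinom_split z p r :
  gbinom z (p + r) * 'C(p + r, r)%:R = gbinom z p * gbinom (z - p%:R) r.
Proof.
elim: r => [|r IH]; first by rewrite addn0 bin0 gbinom0 !mulr1.
apply: (mulfI_natS r).
have binS : r.+1%:R * 'C(p + r.+1, r.+1)%:R
    = (p + r).+1%:R * 'C(p + r, r)%:R :> R.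
  by rewrite -!natrM addnS mul_bin_diag.
rewrite mulrCA binS addnS mulrCA mulrA gbinomS -mulrA IH.
rewrite [RHS]mulrCA gbinomS natrD; ring.
Qed.

(** The coefficient of [(1 + x)^m] in [P_n^(a,b)]. *)
Definition jcoef a b n m : R := (-1) ^+ (n - m) / 2 ^+ m *
  (gbinom (n%:R + b) (n - m) * gbinom (n%:R + m%:R + a + b) m).

Definition jpoly a b n : {poly R} := \poly_(m < n.+1) jcoef a b n m.

(** Expand [(x - 1)^(n - l) = (-2 + (1 + x))^(n - l)] in the definition; the
    coefficient of [(1 + x)^m] is then a Vandermonde convolution. *)
Lemma jacobi_jpoly a b n x : (jacobi a b n).[x] = (jpoly a b n).[1 + x].
Proof.
rewrite /jacobi horner_sum /jpoly horner_poly.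
pose y := 1 + x.
pose coef l m : R := gbinom (n%:R + a) l * gbinom (n%:R + b) (n - l) / 2 ^+ n *
  ((-2) ^+ (n - m) *+ 'C(n - l, m - l)).
transitivity (\sum_(0 <= l < n.+1) \sum_(0 <= m < n.+1 | (l <= m)%N)
    coef l m * y ^+ m).
  rewrite big_mkord; apply: eq_bigr => l _.
  have ln : (l <= n)%N by rewrite -ltnS.
  rewrite hornerZ hornerM !horner_exp -polyC1 hornerXsubC hornerD hornerX hornerC.
  have -> : x - 1 = -2 + y by rewrite /y; ring.
  rewrite (exprDn (-2) y (n - l)) -(addrC 1 x) -/y.
  transitivity (\sum_(l <= m < n.+1) coef l m * y ^+ m); last first.
    by rewrite (big_nat_widenl _ 0).
  rewrite -[X in \sum_(X <= _ < _) _]add0n big_addn subSn// big_mkord.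
  rewrite mulr_suml mulr_sumr; apply: eq_bigr => i _.
  have [c natE] : exists c : R, forall e, e *+ 'C(n - l, i) = e * c.
    by exists 'C(n - l, i)%:R => e; rewrite mulr_natr.
  rewrite /coef addnK (addnC i) subnDA.
  rewrite (exprD y) !natE.
  by move: ((-2) ^+ _) (gbinom _ _) (gbinom _ _) => e g1 g2; ring.
rewrite (exchange_big_dep_nat xpredT)//= big_mkord; apply: eq_bigr => m _.
have mn : (m <= n)%N by rewrite -ltnS.
rewrite -mulr_suml; congr (_ * _).
transitivity (\sum_(0 <= l < m.+1) coef l m).
  by rewrite (big_nat_widen 0 m.+1 n.+1).
rewrite big_mkord /jcoef.
have -> : n%:R + m%:R + a + b = (n%:R + a) + (m%:R + b) by ring.
rewrite -(gbinom_vandermonde (n%:R + a)) !mulr_sumr; apply: eq_bigr => l _.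
have lm : (l <= m)%N by rewrite -ltnS.
have := gbinom_split (n%:R + b) (n - m) (m - l).
rewrite addnBA// subnK// natrB//.
have -> : n%:R + b - (n%:R - m%:R) = m%:R + b by ring.
rewrite /coef => H.
rewrite -[(-2) ^+ (n - m) *+ _]mulr_natr.
transitivity ((-2) ^+ (n - m) / 2 ^+ n * gbinom (n%:R + a) l *
   (gbinom (n%:R + b) (n - l) * 'C(n - l, m - l)%:R)); first by ring.
rewrite H.
have -> : (-2) ^+ (n - m) / 2 ^+ n = (-1) ^+ (n - m) / 2 ^+ m :> R.
  have -> : 2 ^+ n = 2 ^+ (n - m) * 2 ^+ m :> R by rewrite -exprD subnK.
  by rewrite -(mulN1r 2) exprMn invfM mulrA mulfK// expf_neq0.
ring.
Qed.

(** * Fractional integral and sup norm of Jacobi polynomials *)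

Lemma Gamma_gbinom b k : 0 < b + 1 ->
  Gamma (b + k%:R + 1) = Gamma (b + 1) * (k`!%:R * gbinom (k%:R + b) k).
Proof.
move=> b0; have gbinom_fact j (z : R) : j`!%:R * gbinom z j = \prod_(i < j) (z - i%:R).
  by rewrite /gbinom mulrC divfK// pnatr_eq0 -lt0n fact_gt0.
rewrite gbinom_fact; elim: k => [|k IH]; first by rewrite addr0 big_ord0 mulr1.
have -> : b + k.+1%:R + 1 = (b + k%:R + 1) + 1 by rewrite -natr1; ring.
rewrite GammaS; last by have := ler0n R k; lra.
rewrite IH big_ord_recl/= subr0 -natr1.
under [X in _ = _ * (_ * X)]eq_bigr => i _.
  have -> : k%:R + 1 + b - (bump 0 i)%:R = k%:R + b - i%:R.
    by rewrite /bump/= add1n -natr1; ring.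
  over.
ring.
Qed.

(** The parameter sum [a + b] is the same on both sides, so only the factor
    [gbinom (n + b) (n - m)] of [jcoef] changes; [Gamma_gbinom] turns the
    quotients of Gamma at [b + m + 1] into quotients at [b + n + 1]. *)
Lemma jcoef_frac a b nu n m : 0 < b + 1 -> 0 < nu -> (m <= n)%N ->
  jcoef a b n m *
    (Gamma (b + m%:R + 1) * Gamma nu / Gamma (b + m%:R + 1 + nu)) =
  Gamma nu * (Gamma (b + n%:R + 1) / Gamma (b + nu + n%:R + 1)) *
    jcoef (a - nu) (b + nu) n m.
Proof.
move=> b0 nu0 mn.
have bm0 : 0 < b + m%:R + 1 by have := ler0n R m; lra.
have G1 := Gamma_gbinom (b + m%:R) (n - m) bm0.
have bn0 : 0 < b + nu + m%:R + 1 by have := ler0n R m; lra.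
have G2 := Gamma_gbinom (b + nu + m%:R) (n - m) bn0.
have nmE : (n - m)%:R = n%:R - m%:R :> R by rewrite natrB.
have E1 z : z + m%:R + (n - m)%:R + 1 = z + n%:R + 1 by rewrite nmE; ring.
have E2 z : (n - m)%:R + (z + m%:R) = n%:R + z by rewrite nmE; ring.
rewrite E1 E2 in G1; rewrite E1 E2 in G2.
have E3 : b + m%:R + 1 + nu = b + nu + m%:R + 1 by ring.
have Gn0 : Gamma (b + nu + n%:R + 1) != 0.
  by rewrite gt_eqF// Gamma_gt0//; have := ler0n R n; lra.
have Gm0 : Gamma (b + nu + m%:R + 1) != 0 by rewrite gt_eqF// Gamma_gt0.
rewrite /jcoef E3 G1.
have -> : n%:R + m%:R + (a - nu) + (b + nu) = n%:R + m%:R + a + b by ring.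
move: Gn0; rewrite G2.
move: ((-1) ^+ _ / _) (gbinom (n%:R + b) _) (gbinom (n%:R + (b + nu)) _)
  (gbinom (n%:R + m%:R + a + b) _) ((n - m)`!%:R) (Gamma (b + m%:R + 1))
  (Gamma nu) (Gamma (b + nu + m%:R + 1)) Gm0 => s g1 g2 g3 d G Gn H H0.
rewrite !mulf_eq0 !negb_or => /and3P[_ d0 g20].
field; by rewrite H0 d0 g20.
Qed.

Lemma integrable_frac_powR b nu x : 0 < b + 1 -> 0 < nu -> -1 < x ->
  mu.-integrable `[-1, x] (EFin \o frac_kernel b nu x).
Proof.
move=> b0 nu0 x1; apply/integrableP; split.
  by apply/measurable_EFinP; apply: measurable_funTS; exact: measurable_frac_kernel.
under eq_integral => t _ do rewrite /= ger0_norm ?frac_kernel_ge0//.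
by rewrite frac_integral_powR// ltry.
Qed.

Lemma powRDn b m x : 0 <= b -> 0 <= x -> x `^ (b + m%:R) = x `^ b * x ^+ m.
Proof.
move=> b0 x0; case: m => [|m]; first by rewrite addr0 expr0 mulr1.
by rewrite powRD ?powR_mulrn// gt_eqF// ltr_wpDl.
Qed.

(** Integrate the powers of [1 + t] one by one: by [jcoef_frac] they all produce
    the same Gamma factor. *)
Lemma frac_integral_jacobi a b nu n x : 0 <= b -> 0 < nu -> -1 < x ->
  (\int[mu]_(t in `[(-1)%R, x])
     ((jacobi a b n).[t] * frac_kernel b nu x t)%:E =
   (Gamma nu * (Gamma (b + n%:R + 1) / Gamma (b + nu + n%:R + 1)) *
    ((1 + x) `^ (b + nu) * (jacobi (a - nu) (b + nu) n).[x]))%:E)%E.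
Proof.
move=> b0 nu0 x1; have x0 : 0 <= 1 + x by rewrite -lerBlDl sub0r ltW.
have bm0 m : 0 < b + m%:R + 1 by have := ler0n R m; lra.
transitivity (\int[mu]_(t in `[(-1)%R, x])
    (\sum_(m < n.+1) (jcoef a b n m * frac_kernel (b + m%:R) nu x t)%:E))%E.
  apply: eq_integral => t; rewrite inE /= in_itv/= => /andP[t1 tx].
  rewrite sumEFin; congr EFin.
  rewrite jacobi_jpoly horner_poly mulr_suml; apply: eq_bigr => m _.
  rewrite /frac_kernel powRDn//; last by rewrite -lerBlDl sub0r.
  ring.
rewrite integral_sum//; last first.
  move=> m.
  change (mu.-integrable `[-1, x] (fun t =>
    ((jcoef a b n m)%:E * (EFin \o frac_kernel (b + m%:R) nu x) t)%E)).
  by apply: integrableZl => //; exact: integrable_frac_powR.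
rewrite jacobi_jpoly horner_poly !mulr_sumr -sumEFin.
apply: eq_bigr => m _.
under eq_integral do rewrite EFinM.
rewrite integralZl//; last exact: integrable_frac_powR.
rewrite frac_integral_powR// -EFinM; congr EFin.
rewrite [LHS]mulrA jcoef_frac//; last 2 first.
- by rewrite ltr_wpDl.
- by rewrite -ltnS.
rewrite (addrAC b m%:R nu) powRDn//; last by rewrite addr_ge0// ltW.
ring.
Qed.

Lemma jacobi_le_sup a b n x : -1 <= x -> x <= 1 ->
  `|(jacobi a b n).[x]| <= jacobi_sup a b n.
Proof.
move=> x1 x2; rewrite /jacobi_sup.
have x12 : -1 <= 1 :> R by rewrite ge0_cp.
have [|c _ cmax] := @EVT_max R (fun x => `|(jacobi a b n).[x]|) (-1) 1 x12.
  apply: continuous_subspaceT => y; apply: continuous_comp.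
    exact: continuous_horner.
  exact: norm_continuous.
apply: ub_le_sup.
  by exists `|(jacobi a b n).[c]| => _ /= [y y1 <-]; exact: cmax.
by exists x => //=; rewrite in_itv/= x1 x2.
Qed.

Lemma jacobi_sup_le a b n (M : R) :
  (forall x, -1 <= x -> x <= 1 -> `|(jacobi a b n).[x]| <= M) ->
  jacobi_sup a b n <= M.
Proof.
move=> PM; apply: ge_sup; last first.
  by move=> _ /= [y /andP[y1 y2] <-]; exact: PM.
exists `|(jacobi a b n).[1]| => /=; exists 1 => //=.
by rewrite in_itv/= lexx andbT ge0_cp.
Qed.

Lemma jacobi_sup_ge0 a b n : 0 <= jacobi_sup a b n.
Proof. exact: le_trans (jacobi_le_sup a b n 1 _ _). Qed.

Lemma poly_norm_le_left_end (p : {poly R}) (M : R) :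
  (forall x, -1 < x -> x <= 1 -> `|p.[x]| <= M) -> `|p.[-1]| <= M.
Proof.
move=> pM.
have cp : `|p.[x]| @[x --> (-1)^'+] --> `|p.[-1]|.
  apply: cvg_at_right_filter; apply: cvg_norm; exact: continuous_horner.
rewrite -(cvg_lim _ cp)//; apply: limr_le; first exact: cvgP cp.
near=> x; apply: pM.
- by near: x; exact: nbhs_right_gt.
- by near: x; apply: nbhs_right_le; rewrite gt0_cp.
Unshelve. all: by end_near. Qed.

Lemma measurable_jacobi_frac a b c nu n x :
  measurable_fun [set: R] (fun t => (jacobi a c n).[t] * frac_kernel b nu x t).
Proof.
apply: measurable_funM; last exact: measurable_frac_kernel.
by apply: continuous_measurable_fun; exact: continuous_horner.
Qed.

Lemma integrable_jacobi_frac a b c nu n x :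
  0 < b + 1 -> 0 < nu -> -1 < x -> x <= 1 ->
  mu.-integrable `[-1, x]
    (fun t => ((jacobi a c n).[t] * frac_kernel b nu x t)%:E).
Proof.
move=> b0 nu0 x1 x2.
apply: (@le_integrable _ _ R mu _ _ _
    (fun t => ((jacobi_sup a c n)%:E * (EFin \o frac_kernel b nu x) t)%E)) => //.
- by apply/measurable_EFinP; apply: measurable_funTS; exact: measurable_jacobi_frac.
- move=> t /=; rewrite in_itv/= => /andP[t1 tx].
  rewrite lee_fin !normrM; apply: ler_wpM2r; first by rewrite mulr_ge0.
  by rewrite (ger0_norm (jacobi_sup_ge0 _ _ _)) jacobi_le_sup// (le_trans tx).
- by apply: integrableZl => //; exact: integrable_frac_powR.
Qed.

(** Bound [P_n^(a,b)] by its sup norm under the integral in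
    [frac_integral_jacobi]: what remains is the fractional integral of [(1 + t)^b],
    and the factor [(1 + x)^(b + nu)] cancels for [x > -1].  The point [-1] is
    reached by continuity. *)
Lemma jacobi_sup_frac a b nu n : 0 <= b -> 0 < nu ->
  Gamma (b + n%:R + 1) / Gamma (b + nu + n%:R + 1) *
    jacobi_sup (a - nu) (b + nu) n <=
  Gamma (b + 1) / Gamma (b + 1 + nu) * jacobi_sup a b n.
Proof.
move=> b0 nu0.
have b10 : 0 < b + 1 by rewrite ltr_wpDl.
set r := _ / _; set C := Gamma (b + 1) / _.
have r0 : 0 < r.
  by rewrite divr_gt0// Gamma_gt0//; have := ler0n R n; lra.
rewrite mulrC -ler_pdivlMr//; apply: jacobi_sup_le.
suff H x : -1 < x -> x <= 1 ->
    `|(jacobi (a - nu) (b + nu) n).[x]| <= C * jacobi_sup a b n / r.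
  move=> x; rewrite le_eqVlt => /predU1P[<- _|]; last exact: H.
  exact: poly_norm_le_left_end.
move=> x1 x2.
have Gnu0 : 0 < Gamma nu by rewrite Gamma_gt0.
have x0 : 0 < 1 + x by rewrite -ltrBlDl sub0r.
have : (`|\int[mu]_(t in `[(-1)%R, x])
       ((jacobi a b n).[t] * frac_kernel b nu x t)%:E| <=
     \int[mu]_(t in `[(-1)%R, x])
       ((jacobi_sup a b n)%:E * (frac_kernel b nu x t)%:E))%E.
  apply: (le_trans (le_abse_integral _ _ _)) => //.
    by apply/measurable_EFinP; apply: measurable_funTS; exact: measurable_jacobi_frac.
  apply: ge0_le_integral => //.
  - apply: measurableT_comp => //.
    by apply/measurable_EFinP; apply: measurable_funTS; exact: measurable_jacobi_frac.
  - apply/measurable_EFinP; apply: measurable_funTS; apply: measurable_funM => //.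
    exact: measurable_frac_kernel.
  move=> t /=; rewrite in_itv/= => /andP[t1 tx].
  rewrite lee_fin normrM [X in _ * X]ger0_norm; last first.
    exact: frac_kernel_ge0.
  apply: ler_wpM2r; first exact: frac_kernel_ge0.
  by rewrite jacobi_le_sup// (le_trans tx).
rewrite frac_integral_jacobi// ge0_integralZl//; last 3 first.
- by apply/measurable_EFinP; apply: measurable_funTS; exact: measurable_frac_kernel.
- by move=> t _; rewrite lee_fin frac_kernel_ge0.
- by rewrite lee_fin jacobi_sup_ge0.
rewrite frac_integral_powR// -EFinM lee_fin -/r.
rewrite (normrM (Gamma nu * r)) (normrM (Gamma nu)) (normrM (_ `^ _)).
rewrite (gtr0_norm Gnu0) (gtr0_norm r0) ger0_norm ?powR_ge0// => H.
rewrite ler_pdivlMr//.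
have p0 : 0 < (1 + x) `^ (b + nu) by rewrite powR_gt0.
rewrite -(ler_pM2l (mulr_gt0 Gnu0 p0)).
have -> : Gamma nu * (1 + x) `^ (b + nu) *
    (`|(jacobi (a - nu) (b + nu) n).[x]| * r)
  = Gamma nu * r * ((1 + x) `^ (b + nu) * `|(jacobi (a - nu) (b + nu) n).[x]|).
  by ring.
apply: (le_trans H); rewrite le_eqVlt; apply/orP; left; apply/eqP.
by rewrite /C; ring.
Qed.

(** * Integer parameters: contiguous relations and the Legendre bound *)

Lemma signr_subn n m : (m <= n)%N -> (-1) ^+ (n - m) = (-1) ^+ (n + m) :> R.
Proof. by move=> mn; rewrite -signr_odd oddB// -oddD signr_odd. Qed.

(** For integer parameters the coefficients are products of binomial
    coefficients that vanish by themselves for [m > n], so that polynomial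
    identities can be checked coefficientwise without case distinctions. *)
Lemma coef_jpoly00 n m : (jpoly (0 : R) 0 n)`_m =
  (-1) ^+ (n + m) / 2 ^+ m * ('C(n, m)%:R * 'C(n + m, m)%:R).
Proof.
rewrite coef_poly ltnS; case: leqP => mn; last by rewrite bin_small ?mul0r ?mulr0.
by rewrite /jcoef signr_subn// !addr0 -natrD !gbinom_nat bin_sub.
Qed.

Lemma coef_jpoly01 n m : (jpoly (0 : R) 1 n)`_m =
  (-1) ^+ (n + m) / 2 ^+ m * ('C(n.+1, m.+1)%:R * 'C((n + m).+1, m)%:R).
Proof.
rewrite coef_poly ltnS; case: leqP => mn.
  have -> : 'C(n.+1, m.+1) = 'C(n.+1, n - m) by rewrite -bin_sub// subSS.
  by rewrite /jcoef signr_subn// !addr0 -natrD !natr1 !gbinom_nat.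
by rewrite (@bin_small n.+1) ?mul0r ?mulr0.
Qed.

Lemma coef_jpoly10 n m : (jpoly (1 : R) 0 n)`_m =
  (-1) ^+ (n + m) / 2 ^+ m * ('C(n, m)%:R * 'C((n + m).+1, m)%:R).
Proof.
rewrite coef_poly ltnS; case: leqP => mn; last by rewrite bin_small ?mul0r ?mulr0.
by rewrite /jcoef signr_subn// !addr0 -natrD natr1 !gbinom_nat bin_sub.
Qed.

Lemma binSr_natr n m :
  m.+1%:R * 'C(n, m.+1)%:R = (n%:R - m%:R) * 'C(n, m)%:R :> R.
Proof. by rewrite -!gbinom_nat gbinomS. Qed.

Lemma binS_diag_natr n m :
  (n%:R + 1) * 'C((n + m).+1, m)%:R = (n%:R + m%:R + 1) * 'C(n + m, m)%:R :> R.
Proof.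
rewrite -natrD !natr1 -!natrM; congr _%:R.
by rewrite mul_bin_down -addSn addnK.
Qed.

Lemma binS_both_natr n m :
  (m%:R + 1) * 'C(n.+1, m.+1)%:R = (n%:R + 1) * 'C(n, m)%:R :> R.
Proof. by rewrite !natr1 -!natrM mul_bin_diag. Qed.

(** The contiguous relation encoded by [R00]: comparing coefficients, it follows
    from Pascal's rule and the first-order recurrences of binomial coefficients. *)
Lemma jpoly_contiguousR n :
  'X * jpoly (0 : R) 1 n = jpoly 0 0 n.+1 + jpoly 0 0 n.
Proof.
apply/polyP => -[|m].
  rewrite coefXM coefD !coef_jpoly00 !bin0 !addn0 exprS expr0; ring.
rewrite coefXM coefD !coef_jpoly00 coef_jpoly01 /=.
rewrite !addSn !addnS.
have E1 := binSr_natr (n + m).+1 m.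
have E2 := binSr_natr n m.
have E3 := binS_both_natr n m.
have E4 : 'C((n + m).+2, m.+1)%:R =
  'C((n + m).+1, m.+1)%:R + 'C((n + m).+1, m)%:R :> R by rewrite binS natrD.
rewrite E4.
move: E1 E2 E3; rewrite -!natr1 natrD.
set x := 'C((n + m).+1, m)%:R; set y := 'C(_.+1, m.+1)%:R.
set b := 'C(n.+1, m.+1)%:R; set c := 'C(n, m.+1)%:R; set d := 'C(n, m)%:R.
move=> E1 E2 E3.
have m0 : m%:R + 1 != 0 :> R by rewrite natr1 pnatr_eq0.
have E1' : (m%:R + 1) * y = (n%:R + 1) * x by rewrite E1; ring.
(* multiplying by [(m + 1)^2] makes the three recurrences applicable *)
have E0 : 2 * (b * x) = b * (y + x) - c * y.
  apply/eqP; rewrite -subr_eq0 -(mulrI_eq0 _ (mulfI (mulf_neq0 m0 m0))).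
  apply/eqP.
  transitivity (((m%:R + 1) * b) * ((m%:R + 1) * x)
    - ((m%:R + 1) * b) * ((m%:R + 1) * y) + ((m%:R + 1) * c) * ((m%:R + 1) * y)).
    by ring.
  by rewrite E1' E2 E3; ring.
have -> : b * (y + x) = 2 * (b * x) + c * y by rewrite E0; ring.
rewrite !exprS; field.
by rewrite expf_neq0.
Qed.

(** The contiguous relation encoded by [S00].  For [n = 0] the last term has
    coefficient 0, which makes the value [0.-1 = 0] of the index harmless. *)
Lemma jpoly_contiguousS n : (2 * n + 1)%:R *: jpoly (0 : R) 0 n =
  n.+1%:R *: jpoly 1 0 n - n%:R *: jpoly 1 0 n.-1.
Proof.
apply/polyP => m; rewrite coefB !coefZ !coef_jpoly10 coef_jpoly00.
case: n => [|n].
  by rewrite !mul0r subr0 muln0 add0n !add0n !mul1r; case: m => [|m];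
     rewrite ?bin0 ?bin0n ?mul0r.
have E1 := binS_diag_natr n.+1 m.
have E2 : (n.+1)%:R * 'C(n, m)%:R = (n.+1%:R - m%:R) * 'C(n.+1, m)%:R :> R.
  have [mn|nm] := leqP m n.+1; first by rewrite -natrB// -!natrM mul_bin_down.
  by rewrite !bin_small// ?mulr0// ltnW.
rewrite /= -(addSn n m).
move: E1 E2; rewrite natrD natrM addSn exprS.
set x := 'C(_.+2, m)%:R; set y := 'C((n + m).+1, m)%:R.
set s := (-1) ^+ (n + m) / 2 ^+ m; set N := n.+1%:R => E1 E2.
rewrite -!(mulrA (-1)) -/s -[n.+2%:R]natr1 -/N.
transitivity (-1 * s * ((N + 1) * x) * 'C(n.+1, m)%:R
  - s * y * (N * 'C(n, m)%:R)); last by ring.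
by rewrite E1 E2; ring.
Qed.

(** Legendre's differential equation [(1 - x^2) P'' - 2 x P' + n (n+1) P = 0],
    where [1 - x^2 = y (2 - y)] and [- 2 x = 2 (1 - y)] for [y = 1 + x].  It
    amounts to the two-term recurrence [cS] between consecutive coefficients. *)
Lemma jpoly00_ode n (p := jpoly (0 : R) 0 n) :
  2 *: ('X * p^`()^`()) - 'X * ('X * p^`()^`()) + 2 *: p^`() - 2 *: ('X * p^`())
    + (n * n.+1)%:R *: p = 0.
Proof.
have cS m : (m.+1 * m.+1)%:R * p`_m.+1 * 2
    = ((m * m.+1)%:R - (n * n.+1)%:R) * p`_m.
  rewrite !coef_jpoly00 addnS !exprS.
  have E1 := binSr_natr n m.
  have E2 : m.+1%:R * 'C((n + m).+1, m.+1)%:R = (n%:R + m%:R + 1) * 'C(n + m, m)%:R :> R.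
    by rewrite -natrD natr1 -!natrM mul_bin_diag.
  move: E1 E2; rewrite !natrM.
  set x := 'C(n, m)%:R; set y := 'C(n + m, m)%:R; set x' := 'C(n, m.+1)%:R.
  set y' := 'C(_.+1, m.+1)%:R => E1 E2.
  set s := (-1) ^+ (n + m).
  transitivity (- (s / 2 ^+ m) * (m.+1%:R * x') * (m.+1%:R * y')).
    by field; rewrite expf_neq0.
  by rewrite E1 E2; ring.
apply/polyP => -[|[|m]];
  rewrite !(coefD, coefN, coefZ, coefXM, coef_deriv, coef0)/=.
- have := cS 0%N; lra.
- have := cS 1%N; lra.
have := cS m.+2; move: (p`_m.+3) (p`_m.+2) => c d cE.
rewrite -!mulrnA -(mulr_natl c (_ * _)) -(mulr_natl d (_ * _)).
rewrite -(mulr_natl c m.+3) -(mulr_natl d m.+2).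
transitivity ((m.+3 * m.+3)%:R * c * 2
  - ((m.+2 * m.+3)%:R - (n * n.+1)%:R) * d); last by rewrite cE subrr.
by rewrite !natrM; ring.
Qed.

Lemma jacobi_at1 a b n : (jacobi a b n).[1] = gbinom (n%:R + a) n.
Proof.
rewrite /jacobi horner_sum big_ord_recr/= big1 => [|l _].
  rewrite add0r subnn gbinom0 !hornerE/= mulr1.
  by rewrite -[1 + 1]/(2 : R) divfK// expf_neq0.
rewrite hornerZ hornerM horner_exp -polyC1 hornerXsubC subrr expr0n.
by rewrite subn_eq0 leqNgt ltn_ord/= mul0r mulr0.
Qed.

(** Sonin's argument.  For [n > 0] let [f = N P^2 + y (2 - y) P'^2] with
    [N = n (n+1)].  Legendre's equation gives [f' = 2 (y - 1) P'^2], so [f] decreases on [[0,1]]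
    and increases on [[1,2]]; hence [N P^2 <= f <= N], the value at both ends. *)
Lemma norm_legendre_le1 n y : 0 <= y -> y <= 2 ->
  `|(jpoly (0 : R) 0 n).[y]| <= 1.
Proof.
move=> y0 y2; set p := jpoly 0 0 n.
have p0 : p.[0] ^+ 2 = 1.
  by rewrite horner_coef0 coef_jpoly00 !bin0 addn0 expr0 divr1 mulr1 mulr1 sqrr_sign.
have p2 : p.[2] ^+ 2 = 1.
  by rewrite /p -[2]/(1 + 1) -jacobi_jpoly jacobi_at1 addr0 gbinom_nat binn expr1n.
case: n @p p0 p2 => [|n] p p0 p2.
  by rewrite /p horner_poly big_ord1 expr0 mulr1 /jcoef !gbinom0 !mulr1 divr1 normr1.
pose N : R := (n.+1 * n.+2)%:R.
have N0 : 0 < N by rewrite ltr0n.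
pose f := N *: (p * p) + 'X * ((2%:P - 'X) * (p^`() * p^`())).
have fE := (hornerD, hornerZ, hornerM, hornerX, hornerC, hornerN).
have f_ge z : 0 <= z -> z <= 2 -> N * p.[z] ^+ 2 <= f.[z].
  move=> z0 z2; rewrite /f !fE lerDl mulr_ge0// mulr_ge0 ?subr_ge0//.
  by rewrite -expr2 sqr_ge0.
have f' z : f^`().[z] = 2 * (z - 1) * p^`().[z] ^+ 2.
  have := congr1 (fun g => g.[z]) (jpoly00_ode n.+1); rewrite -/p -/N.
  rewrite /f !(derivD, derivZ, derivM, derivX, derivC, derivN) !fE.
  move: (p.[z]) (p^`().[z]) (p^`()^`().[z]) => u v w H.
  apply/eqP; rewrite -subr_eq0; apply/eqP.
  transitivity (2 * v * (2 * (z * w) - z * (z * w) + 2 * v - 2 * (z * v) + N * u)).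
    ring.
  by rewrite H mulr0.
have f01 : f.[0] = N by rewrite /f !fE -expr2 p0 mul0r mulr1 addr0.
have f21 : f.[2] = N by rewrite /f !fE -expr2 p2 subrr mul0r mulr0 addr0 mulr1.
have fN : f.[y] <= N.
  have [y1|y1] := leP y 1.
    move: y0; rewrite le_eqVlt => /predU1P[<-|y0]; first by rewrite f01.
    have [c cy] := poly_mvt f y0.
    rewrite f01 f' subr0 => /eqP; rewrite subr_eq => /eqP ->.
    move: cy; rewrite in_itv/= => /andP[_ cy].
    rewrite gerDr; apply: mulr_le0_ge0; last exact: ltW.
    apply: mulr_le0_ge0; last exact: sqr_ge0.
    by apply: mulr_ge0_le0 => //; rewrite subr_le0 ltW// (lt_le_trans cy).
  move: y2; rewrite le_eqVlt => /predU1P[->|y2]; first by rewrite f21.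
  have [c cy] := poly_mvt f y2.
  rewrite f21 f' => /eqP; rewrite subr_eq => /eqP ->.
  move: cy; rewrite in_itv/= => /andP[cy _].
  rewrite lerDr; apply: mulr_ge0; last by rewrite subr_ge0 ltW.
  apply: mulr_ge0; last exact: sqr_ge0.
  by apply: mulr_ge0 => //; rewrite subr_ge0 ltW// (lt_trans y1).
rewrite -(@ler_pXn2r _ 2)// ?nnegrE// expr1n -normrX ger0_norm ?sqr_ge0//.
by rewrite -(ler_pM2l N0) mulr1 (le_trans (f_ge y y0 y2)).
Qed.

(** By [jpoly_contiguousS] and [norm_legendre_le1], the bound [n + 1] for index
    [n] gives [(2n + 3) + (n + 1)^2 = (n + 2)^2] for [(n + 2) P_(n+1)^(1,0)]. *)
Lemma norm_jpoly10_le n y : 0 <= y -> y <= 2 ->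
  `|(jpoly (1 : R) 0 n).[y]| <= n.+1%:R.
Proof.
move=> y0 y2; elim: n => [|n IH].
  by rewrite horner_poly big_ord1 expr0 mulr1 /jcoef !gbinom0 !mulr1 divr1 normr1.
have := congr1 (fun g => g.[y]) (jpoly_contiguousS n.+1).
rewrite /= hornerD hornerN !hornerZ.
have := norm_legendre_le1 n.+1 y y0 y2.
move: (jpoly 0 0 n.+1).[y] (jpoly 1 0 n).[y] (jpoly 1 0 n.+1).[y] IH => u v w vH uH H.
have {}H : n.+2%:R * w = (2 * n.+1 + 1)%:R * u + n.+1%:R * v by rewrite H subrK.
rewrite -(@ler_pM2l _ n.+2%:R)// -[X in X * `|w|]ger0_norm// -normrM H.
apply: (le_trans (ler_normD _ _)); rewrite !normrM !normr_nat.
apply: (@le_trans _ _ ((2 * n.+1 + 1)%:R * 1 + n.+1%:R * n.+1%:R)).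
  by apply: lerD; apply: ler_wpM2l.
by rewrite mulr1 -!natrM -natrD ler_nat; lia.
Qed.

Lemma jacobi10_sup_le n : jacobi_sup (1 : R) 0 n <= n.+1%:R.
Proof.
apply: jacobi_sup_le => x x1 x2; rewrite jacobi_jpoly; apply: norm_jpoly10_le; lra.
Qed.

(** The left end point already gives this value. *)
Lemma jacobi01_sup_ge n : n.+1%:R <= jacobi_sup (0 : R) 1 n.
Proof.
have := jacobi_le_sup (0 : R) 1 n (-1) (lexx _).
rewrite jacobi_jpoly subrr horner_coef0 coef_jpoly01 addn0 bin0 bin1 expr0 divr1.
by rewrite mulr1 normrM normrX normrN1 expr1n mul1r ger0_norm//; apply; rewrite ge0_cp.
Qed.

End JacobiPolynomials.

(** * Complex series *)

Section ComplexSeries.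
Context {R : realType}.
Implicit Types (a b z x y : R).
Local Notation mu := (@lebesgue_measure R).
Local Notation Re := (@complex.Re _).
Local Notation Im := (@complex.Im _).
Local Notation normc := Normc.normc.

Lemma Re_sum I (s : seq I) (P : pred I) (f : I -> R[i]) :
  Re (\sum_(i <- s | P i) f i) = \sum_(i <- s | P i) Re (f i).
Proof. exact: (raddf_sum (@complex.Re R : Rcomplex R -> R)). Qed.

Lemma Im_sum I (s : seq I) (P : pred I) (f : I -> R[i]) :
  Im (\sum_(i <- s | P i) f i) = \sum_(i <- s | P i) Im (f i).
Proof. exact: (raddf_sum (@complex.Im R : Rcomplex R -> R)). Qed.

Lemma normc_ge0 (z : R[i]) : 0 <= normc z.
Proof. by case: z => x y; exact: sqrtr_ge0. Qed.

Lemma normc_real x : normc x%:C = `|x|.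
Proof. by rewrite /normc /= expr0n addr0 sqrtr_sqr. Qed.

Lemma norm_Re_le (z : R[i]) : `|Re z| <= normc z.
Proof.
by case: z => x y /=; rewrite -sqrtr_sqr ler_sqrt ?addr_ge0 ?sqr_ge0// lerDl sqr_ge0.
Qed.

Lemma norm_Im_le (z : R[i]) : `|Im z| <= normc z.
Proof.
by case: z => x y /=; rewrite -sqrtr_sqr ler_sqrt ?addr_ge0 ?sqr_ge0// lerDr sqr_ge0.
Qed.

Lemma normc_le_ReIm (z : R[i]) : normc z <= `|Re z| + `|Im z|.
Proof.
have zE : z = (Re z)%:C + (Im z)%:C * 'i by case: z => x y; simpc.
rewrite [X in normc X]zE; apply: (le_trans (le_normcD _ _)).
rewrite Normc.normcM !normc_real.
have -> : normc ('i : R[i]) = 1.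
  by rewrite /normc /= expr0n add0r expr1n sqrtr1.
by rewrite mulr1.
Qed.

Lemma csum_ReIm (v : nat -> R[i]) (a b : R) :
  series (Re \o v) @ \oo --> a -> series (Im \o v) @ \oo --> b ->
  csum v = a +i* b.
Proof.
move=> ca cb; rewrite /csum.
apply: (@cvg_lim (R[i] : numFieldType)); first exact: norm_hausdorff.
apply/cvgrPdist_lt => e; rewrite ltcE /= => /andP[/eqP ie re].
have e2 : 0 < Re e / 2 by rewrite divr_gt0.
near=> n.
have -> : e = (Re e)%:C by case: (e) ie => /= er ei ->.
rewrite -[`|_|]/((normc _)%:C) ltcR.
apply: (le_lt_trans (normc_le_ReIm _)).
rewrite (splitr (Re e)) ltrD//.
- rewrite /series/= raddfB/= Re_sum.
  near: n; move/cvgrPdist_lt : ca => /(_ _ e2); exact.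
- rewrite /series/= raddfB/= Im_sum.
  near: n; move/cvgrPdist_lt : cb => /(_ _ e2); exact.
Unshelve. all: by end_near. Qed.

Lemma csum_finite (v : nat -> R[i]) N :
  (forall n, (N <= n)%N -> v n = 0) -> csum v = \sum_(n < N) v n.
Proof.
move=> vN; rewrite /csum.
apply: (@cvg_lim (R[i] : numFieldType)); first exact: norm_hausdorff.
apply: cvg_near_cst.
near=> n; have Nn : (N <= n)%N by near: n; exact: nbhs_infty_ge.
rewrite /series/= (big_cat_nat _ Nn)//= big_mkord [X in _ + X]big1_seq ?addr0//.
by move=> i; rewrite mem_index_iota => /andP[_ /andP[Ni _]]; rewrite vN.
Unshelve. all: by end_near. Qed.

Lemma ReM_real (z : R[i]) x : Re (z * x%:C) = Re z * x.
Proof. by case: z => p r /=; rewrite mulr0 subr0. Qed.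

Lemma ImM_real (z : R[i]) x : Im (z * x%:C) = Im z * x.
Proof. by case: z => p r /=; rewrite mulr0 add0r. Qed.

Lemma complex_eta (z : R[i]) : z = Re z +i* Im z.
Proof. by case: z. Qed.

Lemma csum_real_coef (c : nat -> R[i]) (p : nat -> R) (l l' : R) :
  series (fun n => Re (c n) * p n) @ \oo --> l ->
  series (fun n => Im (c n) * p n) @ \oo --> l' ->
  csum (fun n => c n * (p n)%:C) = l +i* l'.
Proof.
move=> cl cl'; apply: csum_ReIm.
- rewrite (_ : _ \o _ = (fun n => Re (c n) * p n))//.
  by apply/funext => n; exact: ReM_real.
- rewrite (_ : _ \o _ = (fun n => Im (c n) * p n))//.
  by apply/funext => n; exact: ImM_real.
Qed.

Lemma summable_ReIm (c : nat -> R[i]) (M : nat -> R) : (forall n, 0 <= M n) ->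
  cvgn (series (fun n => normc (c n) * M n)) ->
  cvgn (series (fun n => `|Re (c n)| * M n)) /\
  cvgn (series (fun n => `|Im (c n)| * M n)).
Proof.
move=> M0 cM; split; apply: series_le_cvg cM => n;
  rewrite ?mulr_ge0 ?normc_ge0// ler_wpM2r// ?norm_Re_le// norm_Im_le//.
Qed.

Lemma natr_div_real (p d : nat) : p%:R / d%:R = (p%:R / d%:R)%:C :> R[i].
Proof. by rewrite fmorph_div !rmorph_nat. Qed.

(** * Termwise fractional integration of Jacobi series *)

Lemma jacobi_series_cvg a b (c : nat -> R) t : -1 <= t -> t <= 1 ->
  cvgn (series (fun n => `|c n| * jacobi_sup a b n)) ->
  cvgn (series (fun n => c n * (jacobi a b n).[t])).
Proof.
move=> t1 t2 cs; apply: normed_cvg; apply: series_le_cvg cs => n /=.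
- exact: normr_ge0.
- by rewrite mulr_ge0// jacobi_sup_ge0.
- by rewrite normrM ler_wpM2l// jacobi_le_sup.
Qed.

(** The partial sums are dominated by the sum of the sup norms times the
    integrable [frac_kernel]. *)
Lemma jacobi_series_frac a b (nu x : R) (c : nat -> R)
    (F := fun t => limn (series (fun n => c n * (jacobi a b n).[t])))
    (I := `[-1, x]%classic) :
  0 <= b -> 0 < nu -> -1 < x -> x <= 1 ->
  cvgn (series (fun n => `|c n| * jacobi_sup a b n)) ->
  mu.-integrable I (fun t => (F t * frac_kernel b nu x t)%:E) /\
  series (fun n => c n * (Gamma nu *
      (Gamma (b + n%:R + 1) / Gamma (b + nu + n%:R + 1)) *
      ((1 + x) `^ (b + nu) * (jacobi (a - nu) (b + nu) n).[x]))) @ \oo -->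
    \int[mu]_(t in I) (F t * frac_kernel b nu x t).
Proof.
move=> b0 nu0 x1 x2 cs; have b10 : 0 < b + 1 by rewrite ltr_wpDl.
pose S := limn (series (fun n => `|c n| * jacobi_sup a b n)).
pose f n t := (series (fun n => c n * (jacobi a b n).[t]) n * frac_kernel b nu x t)%:E.
have sum_le n t : -1 <= t -> t <= 1 ->
    `|series (fun n => c n * (jacobi a b n).[t]) n| <= S.
  move=> t1 t2; apply: (@le_trans _ _ (series (fun n => `|c n| * jacobi_sup a b n) n)).
    apply: (le_trans (ler_norm_sum _ _ _)); apply: ler_sum => i _.
    by rewrite normrM ler_wpM2l// jacobi_le_sup.
  apply: nondecreasing_cvgn_le => //; apply: nondecreasing_series => i _ _.
  by rewrite mulr_ge0// jacobi_sup_ge0.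
have mf n : measurable_fun I (f n).
  apply/measurable_EFinP; apply: measurable_funTS; apply: measurable_funM.
    apply: measurable_sum => i; apply: measurable_funM => //.
    by apply: continuous_measurable_fun; exact: continuous_horner.
  exact: measurable_frac_kernel.
have f_cvg t : I t -> f n t @[n --> \oo] --> (F t * frac_kernel b nu x t)%:E.
  rewrite /I/= in_itv/= => /andP[t1 tx].
  apply: cvg_EFin; first exact: nearW.
  apply: cvgMl; apply: jacobi_series_cvg => //; exact: le_trans tx x2.
have mF : measurable_fun I (fun t => (F t * frac_kernel b nu x t)%:E).
  exact: (emeasurable_fun_cvg f).
have iS : mu.-integrable I (fun t => (S%:E * (EFin \o frac_kernel b nu x) t)%E).
  rewrite /I; apply: integrableZl => //; exact: integrable_frac_powR.
have dom t n : I t -> (`|f n t| <= S%:E * (EFin \o frac_kernel b nu x) t)%E.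
  rewrite /I/= in_itv/= => /andP[t1 tx].
  have k0 := frac_kernel_ge0 b nu x t.
  rewrite lee_fin normrM (ger0_norm k0) ler_wpM2r// sum_le//.
  exact: le_trans tx x2.
have [iF _ fF] := @dominated_convergence _ _ R mu I (measurable_itv _) f
  (fun t => (F t * frac_kernel b nu x t)%:E) _ mf mF (aeW mu f_cvg) iS (aeW mu dom).
split=> //.
have /fineK intF : (\int[mu]_(t in I) (F t * frac_kernel b nu x t)%:E)%E \is a fin_num.
  by rewrite /I; apply: integrable_fin_num.
have := fF; rewrite -intF => /fine_cvg; apply: cvg_trans.
apply: near_eq_cvg; apply: nearW => N /=.
have -> : (\int[mu]_(t in I) f N t = \int[mu]_(t in I) (\sum_(0 <= n < N)
    ((c n)%:E * ((jacobi a b n).[t] * frac_kernel b nu x t)%:E)))%E.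
  apply: eq_integral => t _.
  rewrite /f /series/= mulr_suml -sumEFin; apply: eq_bigr => n _.
  by rewrite -EFinM -mulrA.
rewrite integral_sum; last 2 first.
- exact: measurable_itv.
- by move=> n; rewrite /I; apply: integrableZl => //; exact: integrable_jacobi_frac.
rewrite /series/= -[RHS]/(fine (_)%:E) -sumEFin; congr fine.
apply: eq_bigr => n _; rewrite /I integralZl//; last exact: integrable_jacobi_frac.
by rewrite frac_integral_jacobi.
Qed.

(** * The corner block *)

Definition shift_seq {K : zmodType} (v : nat -> K) (m : nat) : K :=
  if m is k.+1 then v k else 0.

(** The actions of the bidiagonal matrices [R00] and [S00] on coefficient
    sequences; the scalars vary because the actions are applied to complex
    sequences and to their real and imaginary parts. *)
Definition R00_app {K : zmodType} (v : nat -> K) (m : nat) : K :=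
  v m + shift_seq v m.

Definition S00_app {K : fieldType} (r : nat -> K) (m : nat) : K :=
  m.+1%:R / (2 * m + 1)%:R * r m - m.+1%:R / (2 * m.+1 + 1)%:R * r m.+1.

(** The contiguous relations summed by parts: the partial sums of the two
    expansions differ by two boundary terms. *)
Lemma sum_contiguous (v : nat -> R) y N :
  \sum_(m < N) S00_app (R00_app v) m * (jpoly 1 0 m).[y] =
  y * (\sum_(n < N) v n * (jpoly 0 1 n).[y])
  - shift_seq v N * (jpoly 0 0 N).[y]
  - N%:R / (2 * N + 1)%:R * R00_app v N * (jpoly 1 0 N.-1).[y].
Proof.
elim: N => [|N IH]; first by rewrite !big_ord0 !mul0r mulr0 !subr0.
rewrite !big_ord_recr/= IH.
have HR : y * (jpoly 0 1 N).[y] = (jpoly 0 0 N.+1).[y] + (jpoly 0 0 N).[y].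
  have := congr1 (fun g => g.[y]) (@jpoly_contiguousR R N).
  by rewrite /= hornerM hornerX hornerD.
have HS : (jpoly 0 0 N).[y] = N.+1%:R / (2 * N + 1)%:R * (jpoly 1 0 N).[y]
    - N%:R / (2 * N + 1)%:R * (jpoly 1 0 N.-1).[y].
  have := congr1 (fun g => g.[y]) (@jpoly_contiguousS R N).
  rewrite /= hornerD hornerN !hornerZ => H.
  have d0 : (2 * N + 1)%:R != 0 :> R by rewrite pnatr_eq0 addn1.
  apply: (mulfI d0); rewrite H; move: ((2 * N + 1)%:R) d0 => d d0.
  by field.
rewrite [y * (_ + _)]mulrDr [y * (v N * _)]mulrCA HR !HS /S00_app.
have -> : R00_app v N = v N + shift_seq v N by [].
move: (N.+1%:R / (2 * N + 1)%:R) (N%:R / (2 * N + 1)%:R)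
  (N.+1%:R / (2 * N.+1 + 1)%:R) => s s' s''.
ring.
Qed.

Lemma cvg_shift_seq (A : nat -> R) (l : R) :
  A @ \oo --> l -> shift_seq A @ \oo --> l.
Proof. by move=> Al; rewrite -cvg_shiftS. Qed.

Lemma is_cvg_series_shift_seq (A : nat -> R) :
  cvgn (series A) -> cvgn (series (shift_seq A)).
Proof.
move=> cA; apply/cvg_ex; exists (limn (series A)); rewrite -cvg_shiftS.
apply: cvg_trans cA; apply: near_eq_cvg; apply: nearW => n /=.
by rewrite /series/= big_nat_recl//= add0r.
Qed.

Lemma is_cvg_series_shiftS (A : nat -> R) :
  cvgn (series A) -> cvgn (series (fun n => A n.+1)).
Proof.
move=> cA; apply/cvg_ex; exists (limn (series A) - A 0%N).
have : series A n.+1 - A 0%N @[n --> \oo] --> limn (series A) - A 0%N.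
  apply: cvgB; last exact: cvg_cst.
  by rewrite (cvg_shiftS (series A)).
apply: cvg_trans; apply: near_eq_cvg; apply: nearW => n /=.
by rewrite /series/= big_nat_recl//= addrAC subrr add0r.
Qed.

Lemma S00_coef_le1 m : m.+1%:R / (2 * m + 1)%:R <= 1 :> R /\
  m.+1%:R / (2 * m.+1 + 1)%:R <= 1 :> R.
Proof.
by split; rewrite ler_pdivrMr ?mul1r ?ler_nat ?ltr0n ?addn1//; lia.
Qed.

(** Both boundary terms of [sum_contiguous] are controlled by
    [n |v_(n-1)|] and [(n + 1) |v_n|], general terms of convergent series. *)
Lemma S00_R00_series_cvg (v : nat -> R) y l : 0 <= y -> y <= 2 ->
  cvgn (series (fun n => `|v n| * n.+1%:R)) ->
  series (fun n => v n * (jpoly 0 1 n).[y]) @ \oo --> l ->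
  series (fun m => S00_app (R00_app v) m * (jpoly 1 0 m).[y]) @ \oo --> y * l.
Proof.
move=> y0 y2 cA cl.
pose A n := `|v n| * n.+1%:R.
have A0 : A @ \oo --> 0 by exact: cvg_series_cvg_0.
have A0' : shift_seq A @ \oo --> 0 by exact: cvg_shift_seq.
rewrite [X in X @ _ --> _](_ : _ = fun N =>
   y * series (fun n => v n * (jpoly 0 1 n).[y]) N -
  (shift_seq v N * (jpoly 0 0 N).[y]
  + N%:R / (2 * N + 1)%:R * R00_app v N * (jpoly 1 0 N.-1).[y])); last first.
  by apply/funext => N; rewrite /series/= !big_mkord sum_contiguous; ring.
rewrite -[X in _ --> X]subr0; apply: cvgB; first exact: cvgMr.
apply: norm_cvg0.
apply: (@squeeze_cvgr _ _ _ _ (fun=> 0)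
    (fun N => shift_seq A N + (A N + shift_seq A N))); last 2 first.
- exact: cvg_cst.
- by rewrite -[X in _ --> X](addr0 0); apply: cvgD => //;
    rewrite -[X in _ --> X](addr0 0); apply: cvgD.
apply: nearW => N; rewrite normr_ge0/=; apply: (le_trans (ler_normD _ _)).
apply: lerD.
  rewrite normrM -[leRHS]mulr1; apply: ler_pM => //; last exact: norm_legendre_le1.
  by case: N => [|k]; rewrite ?normr0//= /A ler_peMr// ler1n.
case: N => [|k]; first by rewrite !mul0r normr0 /= addr0 mulr_ge0.
have c0 : 0 <= k.+1%:R / (2 * k.+1 + 1)%:R :> R by rewrite divr_ge0.
rewrite normrM (normrM (_ / _)) (ger0_norm c0).
apply: (@le_trans _ _ (1 * (`|v k.+1| + `|v k|) * k.+1%:R)).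
  apply: ler_pM => //.
    apply: ler_pM => //.
      exact: (S00_coef_le1 k).2.
    exact: ler_normD.
  exact: norm_jpoly10_le.
rewrite mul1r mulrDl lerD2r /A; apply: ler_wpM2l => //.
by rewrite ler_nat.
Qed.

(** The entries of [S00] are at most 1 in absolute value and indices move by at
    most one, which changes the weight [n + 1] by a factor at most 2. *)
Lemma S00_R00_summable (v : nat -> R[i]) (M : nat -> R) :
  (forall n, 0 <= M n <= n.+1%:R) ->
  cvgn (series (fun n => normc (v n) * n.+1%:R)) ->
  cvgn (series (fun n => normc (S00_app (R00_app v) n) * M n)).
Proof.
move=> M0 cA; pose A n := normc (v n) * n.+1%:R.
have A_ge0 n : 0 <= A n by rewrite mulr_ge0// normc_ge0.
have sA_ge0 n : 0 <= shift_seq A n by case: n => /=.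
have : cvgn (series ((A \+ shift_seq A) \+ (A \+ shift_seq A)
    \+ (fun n => A n.+1))).
  apply: is_cvg_seriesD; last exact: is_cvg_series_shiftS.
  by apply: is_cvg_seriesD; apply: is_cvg_seriesD => //; exact: is_cvg_series_shift_seq.
apply: series_le_cvg => n.
- by rewrite mulr_ge0 ?normc_ge0//; have /andP[] := M0 n.
- by rewrite /= !addr_ge0.
apply: (@le_trans _ _ (normc (S00_app (R00_app v) n) * n.+1%:R)).
  by apply: ler_wpM2l; [exact: normc_ge0 | have /andP[] := M0 n].
have normc_coef (c : R) (z : R[i]) : 0 <= c -> c <= 1 -> normc (c%:C * z) <= normc z.
  move=> c0 c1; rewrite Normc.normcM normc_real ger0_norm//.
  by rewrite ler_piMl// normc_ge0.
have [S1 S2] := S00_coef_le1 n.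
apply: (@le_trans _ _
    ((normc (R00_app v n) + normc (R00_app v n.+1)) * n.+1%:R)).
  apply: ler_wpM2r => //; rewrite /S00_app !natr_div_real.
  apply: (le_trans (le_normcD _ _)); rewrite normcN; apply: lerD;
  by apply: normc_coef => //; rewrite divr_ge0.
apply: (@le_trans _ _ ((normc (v n) + normc (shift_seq v n)
    + (normc (v n.+1) + normc (v n))) * n.+1%:R)).
  by apply: ler_wpM2r => //; apply: lerD; exact: le_normcD.
have shift_le : normc (shift_seq v n) * n.+1%:R
    <= shift_seq A n + shift_seq A n.
  case: n {S1 S2} => [|k].
    by rewrite -[shift_seq v 0]/(0 : R[i]) Normc.normc0 mul0r addr0.
  rewrite -[shift_seq v k.+1]/(v k) /= /A -mulrDr.
  apply: ler_wpM2l; first exact: normc_ge0.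
  by rewrite -natrD ler_nat; lia.
have nextS : normc (v n.+1) * n.+1%:R <= A n.+1.
  by apply: ler_wpM2l; [exact: normc_ge0 | rewrite ler_nat].
rewrite !mulrDl -/(A n).
have -> : (A \+ shift_seq A \+ (A \+ shift_seq A) \+ (fun n => A n.+1)) n
  = A n + (shift_seq A n + shift_seq A n) + (A n.+1 + A n).
  by rewrite /=; ring.
by apply: lerD; apply: lerD.
Qed.

End ComplexSeries.

(** * The blocks of the matrix and of the expansion *)

Section BlockOperators.
Context {R : realType}.
Implicit Types (a b z x y : R).
Local Notation mu := (@lebesgue_measure R).
Local Notation Re := (@complex.Re _).
Local Notation Im := (@complex.Im _).
Local Notation normc := Normc.normc.

Lemma imx_app_Qmx (nu b : R) (v : nat -> R[i]) m :
  imx_app (Qmx nu b) v m =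
  (Gamma (b + m%:R + 1) / Gamma (b + nu + m%:R + 1))%:C * v m.
Proof.
rewrite /imx_app (@csum_finite R _ m.+1) => [|n mn].
  rewrite big_ord_recr/= /Qmx eqxx big1 ?add0r// => i _.
  by rewrite gtn_eqF ?mul0r.
by rewrite /Qmx ltn_eqF ?mul0r.
Qed.

Lemma imx_mul_Qmx (A : imx R) (nu b : R) m n :
  imx_mul A (Qmx nu b) m n =
  A m n * (Gamma (b + n%:R + 1) / Gamma (b + nu + n%:R + 1))%:C.
Proof.
rewrite /imx_mul (@csum_finite R _ n.+1) => [|l nl].
  rewrite big_ord_recr/= /Qmx eqxx big1 ?add0r// => i _.
  by rewrite ltn_eqF ?mulr0.
by rewrite /Qmx gtn_eqF ?mulr0.
Qed.

Lemma imx_mul_S00_R00 m n : imx_mul (S00 R) (R00 R) m n =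
  m.+1%:R / (2 * m + 1)%:R * R00 R m n
  - m.+1%:R / (2 * m.+1 + 1)%:R * R00 R m.+1 n.
Proof.
rewrite /imx_mul (@csum_finite R _ m.+2) => [|l ml].
  rewrite !big_ord_recr/= big1 ?add0r => [|i _].
    by rewrite /S00 eqxx (ltn_eqF (ltnSn m)) eqxx mulNr.
  by rewrite /S00 gtn_eqF ?gtn_eqF ?mul0r// ltnW// ltnS.
by rewrite /S00 !ltn_eqF ?mul0r// ltnW.
Qed.

Lemma sum_R00 (v : nat -> R[i]) m N : (m < N)%N ->
  \sum_(n < N) R00 R m n * v n = R00_app v m.
Proof.
move=> mN; rewrite (eq_bigr (fun n : 'I_N => (if n == Ordinal mN then v n else 0)
    + (if n.+1 == m then v n else 0))) => [|n _]; last first.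
  rewrite /R00 -val_eqE /= [m == n]eq_sym [m == n.+1]eq_sym.
  have [->|_] := eqVneq (n : nat) m.
    by rewrite mul1r gtn_eqF// addr0.
  by rewrite add0r /=; case: (n.+1 == m); rewrite ?mul1r ?mul0r.
rewrite big_split/= -big_mkcond big_pred1_eq /R00_app; congr (_ + _).
rewrite -big_mkcond/=; case: m mN => [|k] kN /=; first by rewrite big1.
by rewrite (big_pred1 (Ordinal (ltnW kN))).
Qed.

(** Row [m] of the product has entries only in columns up to [m + 1], so the
    infinite sums that define the product and its action are finite and can be
    reassociated. *)
Lemma imx_app_corner (nu b : R) (u : nat -> R[i]) m :
  imx_app (imx_mul (imx_mul (S00 R) (R00 R)) (Qmx nu b)) u m =
  S00_app (R00_app (imx_app (Qmx nu b) u)) m.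
Proof.
set v := imx_app (Qmx nu b) u.
have appE n : imx_mul (imx_mul (S00 R) (R00 R)) (Qmx nu b) m n * u n =
    m.+1%:R / (2 * m + 1)%:R * (R00 R m n * v n)
    - m.+1%:R / (2 * m.+1 + 1)%:R * (R00 R m.+1 n * v n).
  by rewrite imx_mul_Qmx -mulrA -imx_app_Qmx -/v imx_mul_S00_R00 mulrBl !mulrA.
rewrite /imx_app (@csum_finite R _ m.+2) => [|n mn].
  under eq_bigr do rewrite appE.
  by rewrite sumrB -!mulr_sumr !sum_R00// ltnW.
rewrite appE /R00 !(ltn_eqF, ltnS)//= ?mul0r ?mulr0 ?subrr//; lia.
Qed.

Lemma jacobi_csumE a b (c : nat -> R[i]) t : -1 <= t -> t <= 1 ->
  cvgn (series (fun n => normc (c n) * jacobi_sup a b n)) ->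
  csum (fun n => c n * ((jacobi a b n).[t])%:C) =
  limn (series (fun n => Re (c n) * (jacobi a b n).[t])) +i*
  limn (series (fun n => Im (c n) * (jacobi a b n).[t])).
Proof.
move=> t1 t2 /summable_ReIm[n|cR cI]; first exact: jacobi_sup_ge0.
by apply: csum_real_coef; exact: jacobi_series_cvg.
Qed.

Definition jacobi_block a b (c : nat -> R[i]) t : R[i] :=
  ((1 + t) `^ b)%:C * csum (fun n => c n * ((jacobi a b n).[t])%:C).

(** [jacobi_series_frac] for the real and the imaginary part.  The integrability
    statements serve to add up the integrals of the blocks. *)
Lemma jacobi_block_frac a b nu x (c : nat -> R[i])
    (f := fun t => jacobi_block a b c t / ((x - t) `^ (1 - nu))%:C) :
  0 <= b -> 0 < nu -> -1 < x -> x <= 1 ->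
  cvgn (series (fun n => normc (c n) * jacobi_sup a b n)) ->
  [/\ mu.-integrable `[-1, x] (fun t => (Re (f t))%:E),
      mu.-integrable `[-1, x] (fun t => (Im (f t))%:E) &
      ((Gamma nu)^-1)%:C * cintegral `[-1, x] f =
      jacobi_block (a - nu) (b + nu) (imx_app (Qmx nu b) c) x].
Proof.
move=> b0 nu0 x1 x2 cs.
have [n|cR cI] := summable_ReIm _ _ _ cs; first exact: jacobi_sup_ge0.
have [iR sR] := jacobi_series_frac _ _ _ _ _ b0 nu0 x1 x2 cR.
have [iI sI] := jacobi_series_frac _ _ _ _ _ b0 nu0 x1 x2 cI.
have fE t : t \in `[-1, x] -> f t =
    (limn (series (fun n => Re (c n) * (jacobi a b n).[t])) * frac_kernel b nu x t)
    +i* (limn (series (fun n => Im (c n) * (jacobi a b n).[t])) * frac_kernel b nu x t).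
  rewrite in_itv/= => /andP[t1 tx].
  rewrite /f /jacobi_block jacobi_csumE//; last exact: le_trans tx x2.
  rewrite -fmorphV mulrAC -rmorphM mulrC /frac_kernel.
  by rewrite [LHS]complex_eta ReM_real ImM_real.
have RefE : {in `[-1, x]%classic, (fun t => (Re (f t))%:E) =1 (fun t =>
    (limn (series (fun n => Re (c n) * (jacobi a b n).[t])) * frac_kernel b nu x t)%:E)}.
  by move=> t; rewrite inE => /fE ->.
have ImfE : {in `[-1, x]%classic, (fun t => (Im (f t))%:E) =1 (fun t =>
    (limn (series (fun n => Im (c n) * (jacobi a b n).[t])) * frac_kernel b nu x t)%:E)}.
  by move=> t; rewrite inE => /fE ->.
split.
- by apply: eq_integrable iR => // t It; rewrite RefE.
- by apply: eq_integrable iI => // t It; rewrite ImfE.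
pose p := \int[mu]_(t in `[-1, x])
  (limn (series (fun n => Re (c n) * (jacobi a b n).[t])) * frac_kernel b nu x t).
pose r := \int[mu]_(t in `[-1, x])
  (limn (series (fun n => Im (c n) * (jacobi a b n).[t])) * frac_kernel b nu x t).
have -> : cintegral `[-1, x] f = p +i* r.
  rewrite /cintegral; congr (_ +i* _); apply: eq_Rintegral => t;
  by rewrite inE => /fE ->.
have Gn0 : Gamma nu != 0 by rewrite gt_eqF// Gamma_gt0.
have p0 : (1 + x) `^ (b + nu) != 0.
  by rewrite gt_eqF// powR_gt0// -ltrBlDl sub0r.
pose k := (Gamma nu * (1 + x) `^ (b + nu))^-1.
have scale (d : nat -> R) (l : R) :
    series (fun n => d n * (Gamma nu *
      (Gamma (b + n%:R + 1) / Gamma (b + nu + n%:R + 1)) *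
      ((1 + x) `^ (b + nu) * (jacobi (a - nu) (b + nu) n).[x]))) @ \oo --> l ->
    series (fun n => d n * (Gamma (b + n%:R + 1) / Gamma (b + nu + n%:R + 1))
      * (jacobi (a - nu) (b + nu) n).[x]) @ \oo --> k * l.
  move=> dl; rewrite [X in X @ _ --> _](_ : _ = fun N => k * series (fun n =>
    d n * (Gamma nu * (Gamma (b + n%:R + 1) / Gamma (b + nu + n%:R + 1)) *
    ((1 + x) `^ (b + nu) * (jacobi (a - nu) (b + nu) n).[x]))) N).
    exact: cvgMr.
  apply/funext => N; rewrite /series/= mulr_sumr; apply: eq_bigr => n _.
  move: (Gamma (b + n%:R + 1) / _) (horner _ _) => g h.
  by rewrite /k; field; rewrite Gn0 p0.
rewrite /jacobi_block (csum_real_coef _ _ (k * p) (k * r)).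
- rewrite [LHS]mulrC [RHS]mulrC [LHS]complex_eta [RHS]complex_eta !ReM_real !ImM_real/=.
  by congr (_ +i* _); rewrite /k; field; rewrite Gn0 p0.
- under eq_fun do rewrite imx_app_Qmx [_%:C * c _]mulrC ReM_real.
  exact: scale.
- under eq_fun do rewrite imx_app_Qmx [_%:C * c _]mulrC ImM_real.
  exact: scale.
Qed.

Lemma Rintegral_sum n (D : set R) (f : 'I_n -> R -> R) : measurable D ->
  (forall k, mu.-integrable D (fun t => (f k t)%:E)) ->
  \int[mu]_(t in D) (\sum_(k < n) f k t) = \sum_(k < n) \int[mu]_(t in D) f k t.
Proof.
move=> mD intf; rewrite /Rintegral.
under eq_integral do rewrite -sumEFin.
rewrite integral_sum// -[RHS]/(fine (_)%:E) -sumEFin; congr fine.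
by apply: eq_bigr => k _; rewrite fineK//; exact: integrable_fin_num.
Qed.

Lemma cintegral_sum n (D : set R) (f : 'I_n -> R -> R[i]) : measurable D ->
  (forall k, mu.-integrable D (fun t => (Re (f k t))%:E)) ->
  (forall k, mu.-integrable D (fun t => (Im (f k t))%:E)) ->
  cintegral D (fun t => \sum_(k < n) f k t) = \sum_(k < n) cintegral D (f k).
Proof.
move=> mD iR iI; rewrite [RHS]complex_eta Re_sum Im_sum /cintegral/=.
rewrite -!Rintegral_sum//; congr (_ +i* _); apply: eq_Rintegral => t _.
  exact: Re_sum.
exact: Im_sum.
Qed.

(** Comparison test: the constant in [jacobi_sup_frac] does not depend on [n]. *)
Lemma Qmx_summable a b nu (c : nat -> R[i]) : 0 <= b -> 0 < nu ->
  cvgn (series (fun n => normc (c n) * jacobi_sup a b n)) ->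
  cvgn (series (fun n =>
    normc (imx_app (Qmx nu b) c n) * jacobi_sup (a - nu) (b + nu) n)).
Proof.
move=> b0 nu0 cs; pose C := Gamma (b + 1) / Gamma (b + 1 + nu).
have C0 : 0 <= C by rewrite divr_ge0// ltW// Gamma_gt0//; lra.
have : cvgn (series (fun n => C *: (normc (c n) * jacobi_sup a b n))).
  exact: is_cvg_seriesZ.
apply: series_le_cvg => n.
- by rewrite mulr_ge0 ?normc_ge0 ?jacobi_sup_ge0.
- by rewrite mulr_ge0// mulr_ge0 ?normc_ge0 ?jacobi_sup_ge0.
rewrite imx_app_Qmx Normc.normcM normc_real ger0_norm; last first.
  by rewrite divr_ge0// ltW// Gamma_gt0//; have := ler0n R n; lra.
rewrite mulrAC mulrC [leRHS]mulrCA ler_wpM2l ?normc_ge0//.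
exact: jacobi_sup_frac.
Qed.

Lemma S00_R00_real_linear (v : nat -> R[i]) (re : R[i] -> R) :
  (forall (c : R) (z : R[i]), re (c%:C * z) = c * re z) ->
  {morph re : z w / z + w} -> re 0 = 0 ->
  re \o S00_app (R00_app v) =1 S00_app (R00_app (re \o v)).
Proof.
move=> reM reD re0 m.
have reR k : re (R00_app v k) = R00_app (re \o v) k.
  by rewrite /R00_app reD; case: k => [|k] /=; rewrite ?re0.
rewrite /= /S00_app !natr_div_real -mulNr -rmorphN reD !reM !reR.
by rewrite mulNr.
Qed.

(** [S00_R00_series_cvg] for the real and the imaginary part, the outer powers of
    [1 + x] with exponents 0 and 1 accounting for its factor [y = 1 + x]. *)
Lemma jacobi_block_corner x (v : nat -> R[i]) : -1 <= x -> x <= 1 ->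
  cvgn (series (fun n => normc (v n) * jacobi_sup (0 : R) 1 n)) ->
  jacobi_block 1 0 (S00_app (R00_app v)) x = jacobi_block 0 1 v x.
Proof.
move=> x1 x2 cv.
have y0 : 0 <= 1 + x by rewrite -lerBlDl sub0r.
have y2 : 1 + x <= 2 by lra.
have [n|cR cI] := summable_ReIm _ _ _ cv; first exact: jacobi_sup_ge0.
have part (re : R[i] -> R) : cvgn (series (fun n => `|re (v n)| * jacobi_sup (0 : R) 1 n)) ->
    series (fun n => S00_app (R00_app (re \o v)) n * (jacobi 1 0 n).[x]) @ \oo -->
    (1 + x) * limn (series (fun n => re (v n) * (jacobi 0 1 n).[x])).
  move=> cre; under eq_fun do rewrite jacobi_jpoly.
  apply: S00_R00_series_cvg => //.
    apply: series_le_cvg cre => n.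
    - by rewrite mulr_ge0.
    - by rewrite mulr_ge0// jacobi_sup_ge0.
    - by rewrite ler_wpM2l// jacobi01_sup_ge.
  under eq_fun do rewrite -jacobi_jpoly.
  exact: jacobi_series_cvg.
rewrite /jacobi_block powRr0 mul1r powRr1//.
rewrite (jacobi_csumE 0 1 v x x1 x2 cv).
have S00Re := S00_R00_real_linear v Re.
have S00Im := S00_R00_real_linear v Im.
rewrite (csum_real_coef _ _
  ((1 + x) * limn (series (fun n => Re (v n) * (jacobi 0 1 n).[x])))
  ((1 + x) * limn (series (fun n => Im (v n) * (jacobi 0 1 n).[x])))).
- by rewrite [RHS]mulrC [RHS]complex_eta ReM_real ImM_real/=; congr (_ +i* _); rewrite mulrC.
- under eq_fun => n.
    rewrite [Re _]S00Re; last 3 first.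
    + by move=> c z; rewrite mulrC ReM_real mulrC.
    + by case=> p r; case.
    + by [].
    over.
  exact: part.
- under eq_fun => n.
    rewrite [Im _]S00Im; last 3 first.
    + by move=> c z; rewrite mulrC ImM_real mulrC.
    + by case=> p r; case.
    + by [].
    over.
  exact: part.
Qed.

End BlockOperators.

Section BlockRows.
Context {R : realType}.
Variables (q : nat) (u : blockseq R q.+1).
Let nu : R := q.+1%:R^-1.
Let prev (k : 'I_q) : 'I_q.+1 := widen_ord (leqnSn q) k.

Lemma imx_app_zero (v : nat -> R[i]) m : imx_app (fun _ _ => 0) v m = 0.
Proof.
by rewrite /imx_app (@csum_finite R _ 0) ?big_ord0// => n _; rewrite mul0r.
Qed.

Lemma bexp_lift (k : 'I_q) : bexp R (lift ord0 k) = bexp R (prev k) + nu.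
Proof. by rewrite /bexp /nu /= /bump/= add1n -natr1 mulrDl mul1r. Qed.

Lemma bexp_max : bexp R (@ord_max q) = 1 - nu.
Proof.
rewrite /bexp -[X in _ = X - _](@divff _ q.+1%:R) ?pnatr_eq0// -[X in _ = _ - X]mul1r -mulrBl.
by rewrite -natr1 addrK.
Qed.

(** The index [lift ord0 k] has value [k + 1], so the only nonzero block of this
    row is the subdiagonal one, in column [k]. *)
Lemma bmx_app_lift (k : 'I_q) : bmx_app (@Qblock R q.+1) u (lift ord0 k) =
  imx_app (Qmx nu (bexp R (prev k))) (u (prev k)).
Proof.
apply/funext => m; rewrite /bmx_app (bigD1 (prev k))//= big1 => [|l lk].
  by rewrite addr0 /Qblock/= /bump/= add1n eqxx.
rewrite /Qblock/= /bump/= add1n eqSS -val_eqE/= in lk *.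
by rewrite eq_sym (negbTE lk) imx_app_zero.
Qed.

Lemma bmx_app_0 : bmx_app (@Qblock R q.+1) u ord0 =
  S00_app (R00_app (imx_app (Qmx nu (bexp R (@ord_max q))) (u ord_max))).
Proof.
apply/funext => m; rewrite /bmx_app (bigD1 ord_max)//= big1 => [|l lk].
  by rewrite addr0 /Qblock/= eqxx imx_app_corner bexp_max.
rewrite /Qblock/= eqSS -val_eqE/= in lk *.
by rewrite (negbTE lk) imx_app_zero.
Qed.

End BlockRows.

Theorem theorem7p3 (R : realType) (q : nat) (hq : (1 <= q)%N)
    (u : blockseq R q) (hu : sumspace u) :
  sumspace (bmx_app (@Qblock R q) u) /\
  forall x : R, -1 < x -> x <= 1 ->
    fracint q%:R^-1 (sumspace_eval u) x =
    sumspace_eval (bmx_app (@Qblock R q) u) x.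
Proof.
case: q hq u hu => [//|q] _ u hu.
set nu : R := q.+1%:R^-1.
have nu0 : 0 < nu by rewrite invr_gt0.
have b0 (k : 'I_q.+1) : 0 <= bexp R k by rewrite divr_ge0.
have summable k := Qmx_summable _ _ nu _ (b0 k) nu0 (hu k).
have liftE (k : 'I_q) : 1 - bexp R (lift ord0 k) =
    1 - bexp R (widen_ord (leqnSn q) k) - nu.
  by rewrite bexp_lift opprD addrA.
have b1 : bexp R (@ord_max q) + nu = 1 by rewrite bexp_max subrK.
have a0 : 1 - bexp R (@ord_max q) - nu = 0 by rewrite -addrA -opprD b1 subrr.
have cb0 : bexp R (@ord0 q) = 0 by rewrite /bexp mul0r.
have := summable ord_max; rewrite a0 b1 => corner_summable.
split=> [j|x x1 x2].
  case: (unliftP ord0 j) => [k|] ->.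
    by rewrite bmx_app_lift liftE bexp_lift; exact: summable.
  rewrite bmx_app_0 cb0 subr0; apply: S00_R00_summable => [n|].
    by rewrite jacobi_sup_ge0 jacobi10_sup_le.
  apply: series_le_cvg corner_summable => n.
  - by rewrite mulr_ge0// normc_ge0.
  - by rewrite mulr_ge0 ?normc_ge0 ?jacobi_sup_ge0.
  - by rewrite ler_wpM2l ?normc_ge0// jacobi01_sup_ge.
have block k := jacobi_block_frac _ _ _ _ _ (b0 k) nu0 x1 x2 (hu k).
(* the common value: each block is integrated, before re-expansion of the last *)
transitivity (\sum_(k < q.+1) jacobi_block (1 - bexp R k - nu) (bexp R k + nu)
    (imx_app (Qmx nu (bexp R k)) (u k)) x).
  rewrite /fracint.
  rewrite (_ : (fun t => _) = (fun t => \sum_(k < q.+1)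
    jacobi_block (1 - bexp R k) (bexp R k) (u k) t / ((x - t) `^ (1 - nu))%:C)).
    rewrite cintegral_sum//; last 2 first.
    + by move=> k; have [] := block k.
    + by move=> k; have [] := block k.
    by rewrite mulr_sumr; apply: eq_bigr => k _; have [] := block k.
  by apply/funext => t; rewrite /sumspace_eval mulr_suml.
(* the last integrated block is the first block of the result *)
rewrite big_ord_recr [RHS]/sumspace_eval big_ord_recl/= addrC; congr (_ + _).
  rewrite a0 b1 -jacobi_block_corner ?(ltW x1)//.
  by rewrite bmx_app_0 /jacobi_block cb0 subr0.
by apply: eq_bigr => k _; rewrite bmx_app_lift /jacobi_block liftE bexp_lift.
Qed.
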